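(* Let $k\subset\mathbb{R}$ be a subfield. On the set $\mathbf{Pol}_k(3)$ the pyramidal growth $\underset{\Delta}{\le}$ coincides with the inclusion order: for all $P,Q\in\mathbf{Pol}_k(3)$ with $P\subset Q$ there is a finite chain $P=R_0\subset R_1\subset\cdots\subset R_m=Q$ in $\mathbf{Pol}_k(3)$ such that each pair $R_{j-1}\subset R_j$ is a pyramidal extension.
   Context: Work in $\bigoplus_{\mathbb N}\mathbb{R}$ with its usual Euclidean structure. A polytope is the convex hull of a finite set of points. For a subfield $k\subset\mathbb R$, $\mathbf{Pol}_k(3)$ is the set of polytopes of dimension at most $3$ whose vertices lie in $\bigoplus_{\mathbb N}k$. A pyramid over a polytope $P$ is $\operatorname{conv}(P\cup\{v\})$ with $v$ not in the affine hull of $P$. A pair $P\subset Q$ of polytopes is a pyramidal extension if $\Delta=\overline{Q\setminus P}$ (closure) is a pyramid and $\Delta\cap P$ is a facet of $\Delta$ (so either $Q$ is a pyramid over $P$ or $Q$ is obtained from $P$ by stacking a pyramid onto a facet of $P$). The pyramidal growth $\underset{\Delta}{\le}$ on $\mathbf{Pol}_k(3)$ is the partial order generated by pyramidal extensions within $\mathbf{Pol}_k(3)$. *)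

(* Defs.v *)
From HB Require Import structures.
From Stdlib Require Import Relation_Operators.
From mathcomp Require Import all_boot all_order all_algebra.
From mathcomp Require Import ring lra.
From mathcomp Require Import boolp classical_sets cardinality reals.
From mathcomp Require Import topology normedtype.

Set Implicit Arguments.
Unset Strict Implicit.
Unset Printing Implicit Defensive.

Import Order.TTheory GRing.Theory Num.Theory.
Import numFieldNormedType.Exports.

Local Open Scope classical_set_scope.
Local Open Scope ring_scope.

(* The direct sum of copies of [R] indexed by [nat]: as an [R]-module it is
   [{poly R}], the [i]-th coordinate of [x] being the coefficient [x`_i].  The
   alias carries the Euclidean norm (and its topology). *)
Definition dsum (R : realType) : Type := {poly R}.

HB.instance Definition _ (R : realType) := GRing.Lmodule.on (dsum R).

Section Euclidean.
Variable R : realType.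
Implicit Types x y z : dsum R.

(* The terms with [size x <= i] vanish. *)
Definition dot x y : R :=
  \sum_(i < size (x : {poly R})) (x : {poly R})`_i * (y : {poly R})`_i.

Definition enorm x : R := Num.sqrt (dot x x).

Lemma dot_widen n x y : (size (x : {poly R}) <= n)%N ->
  dot x y = \sum_(i < n) (x : {poly R})`_i * (y : {poly R})`_i.
Proof.
move=> xn; rewrite /dot (big_ord_widen n (fun i => x`_i * y`_i)) //.
rewrite big_mkcond /=; apply: eq_bigr => i _; case: ltnP => // xi.
by rewrite (nth_default 0 xi) mul0r.
Qed.

Lemma dotC x y : dot x y = dot y x.
Proof.
rewrite (dot_widen _ (leq_maxl _ (size (y : {poly R})))).
rewrite [RHS](dot_widen _ (leq_maxr (size (x : {poly R})) _)).
by apply: eq_bigr => i _; rewrite mulrC.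
Qed.

Lemma dotDr x y z : dot x (y + z) = dot x y + dot x z.
Proof.
by rewrite /dot -big_split; apply: eq_bigr => i _; rewrite coefD mulrDr.
Qed.

Lemma dotZr x a y : dot x (a *: y) = a * dot x y.
Proof.
by rewrite /dot mulr_sumr; apply: eq_bigr => i _; rewrite coefZ mulrCA.
Qed.

Lemma dotDl x y z : dot (x + y) z = dot x z + dot y z.
Proof. by rewrite dotC dotDr !(dotC z). Qed.

Lemma dotZl a x y : dot (a *: x) y = a * dot x y.
Proof. by rewrite dotC dotZr dotC. Qed.

Lemma dot_ge0 x : 0 <= dot x x.
Proof. by apply: sumr_ge0 => i _; rewrite -expr2 sqr_ge0. Qed.

Lemma dot_eq0 x : dot x x = 0 -> x = 0.
Proof.
move=> /eqP; rewrite psumr_eq0 => [|i _]; last by rewrite -expr2 sqr_ge0.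
move=> /allP h; apply/polyP => i; rewrite coef0.
have [xi|ix] := leqP (size (x : {poly R})) i; first exact: nth_default.
have := h (Ordinal ix); rewrite mem_index_enum /= mulf_eq0 orbb.
by move=> /(_ isT)/eqP.
Qed.

Lemma dot_CauchySchwarz x y : dot x y ^+ 2 <= dot x x * dot y y.
Proof.
have [/dot_eq0 ->|x0] := eqVneq (dot x x) 0.
  have -> : 0 = 0 *: (0 : dsum R) by rewrite scale0r.
  by rewrite !dotZl !mul0r expr0n.
have xp : 0 < dot x x by rewrite lt_neqAle eq_sym x0 dot_ge0.
have := dot_ge0 (dot x x *: y + (- dot x y) *: x).
rewrite !(dotDl, dotDr, dotZl, dotZr) (dotC y x) => h.
rewrite -subr_ge0 -(pmulr_rge0 _ xp).
by apply: le_trans h _; rewrite le_eqVlt; apply/orP; left; apply/eqP; ring.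
Qed.

Lemma enormD x y : enorm (x + y) <= enorm x + enorm y.
Proof.
rewrite -(ler_pXn2r (n := 2)) ?nnegrE ?addr_ge0 ?sqrtr_ge0 //.
rewrite sqrrD !sqr_sqrtr ?dot_ge0 // dotDl !dotDr (dotC y x).
suff : dot x y <= enorm x * enorm y by lra.
apply: le_trans (ler_norm _) _; rewrite -sqrtrM ?dot_ge0 // -sqrtr_sqr.
by rewrite ler_wsqrtr // dot_CauchySchwarz.
Qed.

Lemma enormZ a x : enorm (a *: x) = `|a| * enorm x.
Proof.
rewrite /enorm dotZl dotZr mulrA -expr2 sqrtrM ?sqr_ge0 //.
by rewrite sqrtr_sqr.
Qed.

Lemma enorm_eq0 x : enorm x = 0 -> x = 0.
Proof.
move=> /eqP; rewrite sqrtr_eq0 => h; apply: dot_eq0.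
by apply/eqP; rewrite eq_le h dot_ge0.
Qed.

HB.instance Definition _ :=
  Lmodule_isNormed.Build R (dsum R) enormD enormZ enorm_eq0.

End Euclidean.

Section Polytopes.
Variable R : realType.
Notation V := (dsum R).
Implicit Types (A B F P Q D : set V) (v x u : V) (k : {pred R}) (d : int).

Definition aff_hull A : set V := [set x |
  exists n (p : 'I_n -> V) (w : 'I_n -> R),
    [/\ forall i, A (p i), \sum_(i < n) w i = 1
      & x = \sum_(i < n) w i *: p i]].

Definition conv_hull A : set V := [set x |
  exists n (p : 'I_n -> V) (w : 'I_n -> R),
    [/\ forall i, A (p i), forall i, 0 <= w i, \sum_(i < n) w i = 1
      & x = \sum_(i < n) w i *: p i]].

Definition aff_independent n (p : 'I_n -> V) : Prop :=
  forall w : 'I_n -> R, \sum_(i < n) w i = 0 ->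
    \sum_(i < n) w i *: p i = 0 -> forall i, w i = 0.

(* [A] has (affine) dimension [d]; the empty set has dimension [-1]. *)
Definition has_dim A d : Prop :=
  exists n (p : 'I_n -> V),
    [/\ forall i, A (p i), aff_independent p, A `<=` aff_hull (range p)
      & d = n%:Z - 1].

Definition polytope P : Prop := exists2 A, finite_set A & P = conv_hull A.

(* On the span of a polytope every linear functional is [dot u] for some [u].
   [u = 0] is allowed, so [set0] and [P] are faces of [P]. *)
Definition face F P : Prop :=
  exists u (c : R), (forall x, P x -> dot u x <= c) /\
    F = P `&` [set x | dot u x = c].

Definition facet F P : Prop :=
  face F P /\ exists d, has_dim F (d - 1) /\ has_dim P d.

Definition vertex v P : Prop := face [set v] P.

Definition Pol k d P : Prop :=
  [/\ polytope P, exists2 e, e <= d & has_dim P e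
    & forall v, vertex v P -> (v : {poly R}) \is a polyOver k].

Definition pyramid_over P D : Prop :=
  exists2 v, ~ aff_hull P v & D = conv_hull (P `|` [set v]).

Definition pyramid D : Prop := exists2 P, polytope P & pyramid_over P D.

Definition pyramidal_extension P Q : Prop :=
  [/\ P `<=` Q, pyramid (closure (Q `\` P))
    & facet (closure (Q `\` P) `&` P) (closure (Q `\` P))].

(* The steps are inclusions, so this preorder is antisymmetric on polytopes. *)
Definition pyramidal_growth k d : set V -> set V -> Prop :=
  clos_refl_trans (set V) (fun P Q =>
    [/\ Pol k d P, Pol k d Q & pyramidal_extension P Q]).

End Polytopes.

(* Main.v *)
(* Adding vertices of Q outside the affine hull of P gives pyramids, so P and Q
   may be assumed to span the same affine space W, of dimension d <= 3.  Cutting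
   Q successively by the facet hyperplanes of P, it suffices to treat the case
   where P is the intersection of Q and a half-space.  Between the two, insert
   the hulls of P and more and more vertices of Q: all their vertices lie on the
   boundary of Q.  So it remains to go from conv S to conv (S, v) when S lies in
   the boundary of conv (S, v); this is an induction on the number of points of
   S seen from v.  Let g = 0 support a facet of conv S seen from v.  The part
   g <= 0 of conv (S, v) is the hull of S and of the points b' where the segments
   [v, b], b in S seen from v, meet g = 0; adding v to it is a single pyramid.
   The points b' are added to S one at a time, by induction: b' sees fewer points
   than v did, because each earlier b' hides its b and, when d <= 3, some vertex
   of the facet is not seen from b'.  All the new points are intersections of
   segments and hyperplanes spanned by points over k, hence are points over k. *)
From HB Require Import structures.
Require Import Defs.
From Stdlib Require Import Relation_Operators Operators_Properties.
From mathcomp Require Import all_boot all_order all_algebra.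
From mathcomp Require Import ring lra.
From mathcomp Require Import boolp classical_sets cardinality reals.
From mathcomp Require Import topology normedtype.

Set Implicit Arguments.
Unset Strict Implicit.
Unset Printing Implicit Defensive.

Import Order.TTheory GRing.Theory Num.Theory.
Import numFieldNormedType.Exports.

Local Open Scope classical_set_scope.
Local Open Scope ring_scope.

Ltac coefwise := apply/polyP => ?; rewrite !(coefD, coefN, coefZ, coef0).

Notation hull s := (conv_hull [set` s]).

(** * Affine functionals, affine and convex hulls, Farkas' lemma and separation *)

Section Affine.
Variable R : realType.
Notation V := (dsum R).
Implicit Types (x y z v : V) (e f g l : V * R) (s t : seq V).

(** Pairs encode affine functionals, so that these form a module and can be rotated by adding
    multiples of one another. *)
Definition ev e x : R := dot e.1 x + e.2.

Lemma evD e f x : ev (e + f) x = ev e x + ev f x.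
Proof. by rewrite /ev dotDl addrACA. Qed.

Lemma evZ (a : R) e x : ev (a *: e) x = a * ev e x.
Proof. by rewrite /ev dotZl /= mulrDr. Qed.

Lemma evN e x : ev (- e) x = - ev e x.
Proof. by rewrite -scaleN1r evZ mulN1r. Qed.

Lemma dotBr x y z : dot x (y - z) = dot x y - dot x z.
Proof. by rewrite -[- z]scaleN1r dotDr dotZr mulN1r. Qed.

Lemma evB e x y : ev e x - ev e y = dot e.1 (x - y).
Proof. by rewrite dotBr /ev opprD addrACA subrr addr0. Qed.

Lemma ev_comb e (a b : R) x y : a + b = 1 ->
  ev e (a *: x + b *: y) = a * ev e x + b * ev e y.
Proof.
move=> ab; rewrite /ev dotDr !dotZr -[X in _ + X]mul1r -ab; ring.
Qed.

Lemma ev_sum e n (w : 'I_n -> R) (p : 'I_n -> V) : \sum_i w i = 1 ->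
  ev e (\sum_i w i *: p i) = \sum_i w i * ev e (p i).
Proof.
move=> w1; rewrite /ev.
under [RHS]eq_bigr do rewrite mulrDr.
rewrite big_split /= -mulr_suml w1 mul1r; congr (_ + _).
have -> : dot e.1 (\sum_i w i *: p i) = \sum_i dot e.1 (w i *: p i).
  apply: (big_morph (dot e.1)); first exact: dotDr.
  by rewrite -(scale0r (0 : V)) dotZr mul0r.
by apply: eq_bigr => i _; rewrite dotZr.
Qed.

Definition convex_set (A : set V) := forall x y (a b : R),
  A x -> A y -> 0 <= a -> 0 <= b -> a + b = 1 -> A (a *: x + b *: y).

Lemma conv_hull_sub (A : set V) : A `<=` conv_hull A.
Proof.
move=> x Ax; exists 1%N, (fun=> x), (fun=> 1).
by split => //; rewrite big_ord1 ?scale1r.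
Qed.

Lemma aff_hull_sub (A : set V) : A `<=` aff_hull A.
Proof.
move=> x Ax; exists 1%N, (fun=> x), (fun=> 1).
by split => //; rewrite big_ord1 ?scale1r.
Qed.

Lemma aff_hull_comb (A : set V) x y (a b : R) :
  aff_hull A x -> aff_hull A y -> a + b = 1 -> aff_hull A (a *: x + b *: y).
Proof.
move=> [n [p [w [pA w1 ->]]]] [m [q [r [qA r1 ->]]]] ab.
exists (n + m)%N, (fun i => match split i with inl j => p j | inr j => q j end),
  (fun i => match split i with inl j => a * w j | inr j => b * r j end).
split=> [i||].
- by case: (split i).
- rewrite big_split_ord /=.
  under eq_bigr do rewrite (unsplitK (inl _)).
  under [X in _ + X]eq_bigr do rewrite (unsplitK (inr _)).
  by rewrite -!mulr_sumr w1 r1 !mulr1.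
- rewrite big_split_ord /=.
  under [X in _ = X + _]eq_bigr do rewrite (unsplitK (inl _)) -scalerA.
  under [X in _ = _ + X]eq_bigr do rewrite (unsplitK (inr _)) -scalerA.
  by rewrite -!scaler_sumr.
Qed.

Lemma conv_hull_convex (A : set V) : convex_set (conv_hull A).
Proof.
move=> x y a b [n [p [w [pA w0 w1 ->]]]] [m [q [r [qA r0 r1 ->]]]] a0 b0 ab.
exists (n + m)%N, (fun i => match split i with inl j => p j | inr j => q j end),
  (fun i => match split i with inl j => a * w j | inr j => b * r j end).
split=> [i|i||].
- by case: (split i).
- by case: (split i) => j; rewrite mulr_ge0.
- rewrite big_split_ord /=.
  under eq_bigr do rewrite (unsplitK (inl _)).
  under [X in _ + X]eq_bigr do rewrite (unsplitK (inr _)).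
  by rewrite -!mulr_sumr w1 r1 !mulr1.
- rewrite big_split_ord /=.
  under [X in _ = X + _]eq_bigr do rewrite (unsplitK (inl _)) -scalerA.
  under [X in _ = _ + X]eq_bigr do rewrite (unsplitK (inr _)) -scalerA.
  by rewrite -!scaler_sumr.
Qed.

Lemma convex_sum (A : set V) n (p : 'I_n -> V) (w : 'I_n -> R) : convex_set A ->
  (forall i, A (p i)) -> (forall i, 0 <= w i) -> \sum_i w i = 1 ->
  A (\sum_i w i *: p i).
Proof.
move=> cA; elim: n p w => [|n IH] p w pA w0.
  by rewrite big_ord0 => /eqP; rewrite eq_sym oner_eq0.
rewrite !big_ord_recl => w1.
set S := \sum_(i < n) w (lift ord0 i) in w1.
have S0 : 0 <= S by apply: sumr_ge0.
have [S00|Sn0] := eqVneq S 0.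
  have wi0 i : w (lift ord0 i) = 0.
    have /eqP := S00; rewrite psumr_eq0 // => /allP /(_ i).
    by rewrite mem_index_enum => /(_ isT) /eqP.
  rewrite big1 ?addr0 => [|i _]; last by rewrite wi0 scale0r.
  by move: w1; rewrite S00 addr0 => ->; rewrite scale1r.
have -> : \sum_(i < n) w (lift ord0 i) *: p (lift ord0 i) =
    S *: \sum_(i < n) (w (lift ord0 i) / S) *: p (lift ord0 i).
  rewrite scaler_sumr; apply: eq_bigr => i _.
  by rewrite scalerA mulrCA divff ?mulr1.
apply: cA => //; apply: IH => [i|i|]; first exact: pA.
  by rewrite divr_ge0.
by rewrite -mulr_suml divff.
Qed.

Lemma conv_hull_min (A B : set V) :
  A `<=` B -> convex_set B -> conv_hull A `<=` B.
Proof.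
by move=> AB cB x [n [p [w [pA w0 w1 ->]]]]; apply: convex_sum => // i; exact: AB.
Qed.

Lemma conv_hullS (A B : set V) : A `<=` B -> conv_hull A `<=` conv_hull B.
Proof.
move=> AB; apply: conv_hull_min; last exact: conv_hull_convex.
by move=> x /AB; exact: conv_hull_sub.
Qed.

Definition affine_set (A : set V) := forall x y (a b : R),
  A x -> A y -> a + b = 1 -> A (a *: x + b *: y).

Lemma aff_hull_affine (A : set V) : affine_set (aff_hull A).
Proof. by move=> *; apply: aff_hull_comb. Qed.

Lemma affine_shift (A : set V) x y z (c : R) : affine_set A ->
  A x -> A y -> A z -> A (x + c *: (y - z)).
Proof.
move=> aA Ax Ay Az; have -> : x + c *: (y - z) = 2^-1 *: (2 *: x + (- 1) *: z)
    + 2^-1 *: ((2 * c) *: y + (1 - 2 * c) *: z).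
  by coefwise; field.
by apply: (aA); [apply: (aA) => //; lra|apply: (aA) => //; lra|lra].
Qed.

Lemma aff_hull_min (A B : set V) :
  A `<=` B -> affine_set B -> aff_hull A `<=` B.
Proof.
move=> AB aB x [[|n] [p [w [pA w1 ->]]]].
  by move: w1; rewrite big_ord0 => /eqP; rewrite eq_sym oner_eq0.
(* Partial sums of the weights may vanish, which rules out the renormalisation used for convex
   combinations; expanding around a base point [b] avoids it. *)
pose b := p ord0.
have Bb : B b by exact: AB (pA _).
have h m (q : 'I_m -> V) (c : 'I_m -> R) : (forall i, B (q i)) ->
    B (b + \sum_i c i *: (q i - b)).
  elim: m q c => [|m IH] q c Bq; first by rewrite big_ord0 addr0.
  by rewrite big_ord_recr /= addrA; apply: affine_shift => //; apply: IH.
have -> : \sum_i w i *: p i = b + \sum_i w i *: (p i - b).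
  under [in RHS]eq_bigr do rewrite scalerBr.
  by rewrite sumrB -scaler_suml w1 scale1r addrCA subrr addr0.
by apply: h => i; apply: AB.
Qed.

Lemma aff_hullS (A B : set V) : A `<=` aff_hull B -> aff_hull A `<=` aff_hull B.
Proof. by move=> AB; apply: aff_hull_min => //; exact: aff_hull_affine. Qed.

Lemma conv_aff (A : set V) : conv_hull A `<=` aff_hull A.
Proof. by move=> x [n [p [w [pA w0 w1 ->]]]]; exists n, p, w. Qed.

Lemma ev_aff0 e (A : set V) x : (forall y, A y -> ev e y = 0) ->
  aff_hull A x -> ev e x = 0.
Proof.
move=> eA [n [p [w [pA w1 ->]]]]; rewrite ev_sum // big1 // => i _.
by rewrite eA ?mulr0.
Qed.

Lemma ev_conv_le0 e (A : set V) x : (forall y, A y -> ev e y <= 0) ->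
  conv_hull A x -> ev e x <= 0.
Proof.
move=> eA [n [p [w [pA w0 w1 ->]]]]; rewrite ev_sum //.
by apply: sumr_le0 => i _; rewrite mulr_ge0_le0 // eA.
Qed.

Lemma conv_face e (A : set V) x : (forall y, A y -> ev e y <= 0) ->
  conv_hull A x -> ev e x = 0 -> conv_hull (A `&` [set y | ev e y = 0]) x.
Proof.
move=> eA Ax ex; set F := conv_hull _.
(* Being strictly negative or in the face survives convex combinations inside the half-space: one
   strictly negative term of positive weight decides. *)
suff : [set y | conv_hull A y /\ (ev e y < 0 \/ F y)] x.
  by case=> _ [|//]; rewrite ex ltxx.
apply: conv_hull_min Ax => [y Ay|y z a b [Ay yF] [Az zF] a0 b0 ab] /=.
  split; first exact: conv_hull_sub.
  have := eA y Ay; rewrite le_eqVlt => /predU1P[ey|]; last by left.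
  by right; apply: conv_hull_sub.
split; first exact: conv_hull_convex.
have ley := ev_conv_le0 eA Ay; have lez := ev_conv_le0 eA Az.
rewrite ev_comb //.
have [a00|an0] := eqVneq a 0.
  move: ab; rewrite a00 add0r => ->.
  by rewrite !scale0r !scale1r mul0r !add0r mul1r.
have [b00|bn0] := eqVneq b 0.
  move: ab; rewrite b00 addr0 => ->.
  by rewrite !scale0r !scale1r mul0r !addr0 mul1r.
have ap : 0 < a by rewrite lt_neqAle eq_sym an0.
have bp : 0 < b by rewrite lt_neqAle eq_sym bn0.
case: yF => [ey|Fy]; first by left; nra.
case: zF => [ez|Fz]; first by left; nra.
by right; apply: conv_hull_convex.
Qed.

Lemma mem_hull s x : x \in s -> hull s x.
Proof. by move=> xs; apply: conv_hull_sub. Qed.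

Lemma sub_hull s t : {subset s <= t} -> hull s `<=` hull t.
Proof. by move=> st; apply: conv_hullS => x /st. Qed.

Lemma hull_min s (A : set V) : (forall x, x \in s -> A x) -> convex_set A ->
  hull s `<=` A.
Proof. by move=> sA cA; apply: conv_hull_min. Qed.

Lemma ev_hull_le0 e s x : (forall y, y \in s -> ev e y <= 0) -> hull s x ->
  ev e x <= 0.
Proof. by move=> es; apply: ev_conv_le0. Qed.

(** The finitely generated convex cone, by recursion on the generators to match the induction in
    Farkas' lemma. *)
Fixpoint cone (s : seq (V * R)) (b : V * R) : Prop :=
  if s is a :: s' then exists2 c : R, 0 <= c & cone s' (b - c *: a) else b = 0.

Definition pdot e f : R := dot e.1 f.1 + e.2 * f.2.

Lemma ev_pdot e x : ev e x = pdot e (x, 1).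
Proof. by rewrite /ev /pdot mulr1. Qed.

Lemma pdotD e f g : pdot e (f + g) = pdot e f + pdot e g.
Proof. by rewrite /pdot dotDr /= mulrDr addrACA. Qed.

Lemma pdotZ e (a : R) f : pdot e (a *: f) = a * pdot e f.
Proof. by rewrite /pdot dotZr /= mulrDr mulrCA. Qed.

Lemma pdotB e f g : pdot e (f - g) = pdot e f - pdot e g.
Proof. by rewrite -scaleN1r pdotD pdotZ mulN1r. Qed.

Lemma pdotC e f : pdot e f = pdot f e.
Proof. by rewrite /pdot dotC mulrC. Qed.

Lemma pdot_gt0 e : e != 0 -> 0 < pdot e e.
Proof.
apply: contraNT; rewrite -leNgt /pdot => h.
have h1 := dot_ge0 e.1; have h2 := sqr_ge0 e.2; rewrite expr2 in h2.
have /dot_eq0 e1 : dot e.1 e.1 = 0 by lra.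
have /eqP : e.2 * e.2 = 0 by lra.
by rewrite mulf_eq0 orbb => /eqP e2; rewrite [e]surjective_pairing e1 e2.
Qed.

(** Undoing a projection along [a0]: as the [c a] are nonpositive, the multiples of [a0] given back
    sum to a nonnegative coefficient. *)
Lemma cone_shift (c : V * R -> R) (a0 : V * R) (s : seq (V * R)) (b : V * R) :
  (forall a, a \in s -> c a <= 0) -> cone [seq a - c a *: a0 | a <- s] b ->
  exists2 m : R, 0 <= m & cone s (b - m *: a0).
Proof.
elim: s b => [|a s IH] b cs /=; first by exists 0; rewrite ?scale0r ?subr0.
case=> d d0 /IH[z zs|m m0 h]; first by apply: cs; rewrite inE zs orbT.
have ca : c a <= 0 by apply: cs; rewrite mem_head.
exists (m - d * c a); first by nra.
exists d => //; suff -> : b - (m - d * c a) *: a0 - d *: a =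
  b - d *: (a - c a *: a0) - m *: a0 by [].
by congr (_, _) => /=; [coefwise; ring|rewrite /= /GRing.scale /=; ring].
Qed.

(* Farkas' lemma, by Bartl's induction on the number of generators. *)
Lemma farkas (s : seq (V * R)) (b : V * R) : cone s b \/
  exists2 e, (forall a, a \in s -> pdot e a <= 0) & 0 < pdot e b.
Proof.
have [n] := ubnP (size s); elim: n s b => // n IH [|a0 s] b /= sn.
  have [->|b0] := eqVneq b 0; first by left.
  by right; exists b => //; exact: pdot_gt0.
have [h|[x xs xb]] := IH s b sn.
  by left; exists 0 => //; rewrite scale0r subr0.
have [xa0|xa0] := leP (pdot x a0) 0.
  by right; exists x => // a; rewrite inE => /predU1P[->//|/xs].
(* [x] fails only at [a0], so everything is projected along [a0] onto the kernel of [x]; a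
   separating [y] found there is corrected by a multiple of [x] to vanish at [a0]. *)
pose c a := pdot x a / pdot x a0.
have cs a : a \in s -> c a <= 0.
  by move=> /xs h; rewrite /c ler_pdivrMr // mul0r.
have [|h|[y ys yb]] := IH [seq a - c a *: a0 | a <- s] (b - c b *: a0).
- by rewrite size_map.
- have [m m0 h'] := cone_shift cs h.
  left; exists (c b + m); last by rewrite scalerDl opprD addrA.
  by rewrite addr_ge0 // divr_ge0 // ltW.
have E a : pdot (y - (pdot y a0 / pdot x a0) *: x) a = pdot y (a - c a *: a0).
  rewrite pdotC pdotB pdotZ pdotB pdotZ !(pdotC a) /c; ring.
right; exists (y - (pdot y a0 / pdot x a0) *: x); last by rewrite E.
move=> a; rewrite E inE => /predU1P[->|sa]; last by apply: ys; apply/mapP; exists a.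
by rewrite /c divff ?gt_eqF // scale1r subrr -(scale0r 0) pdotZ mul0r.
Qed.

(** Dehomogenisation: the cone over points at height 1 meets height 0 only in the origin, and
    rescaling a point of positive height yields a convex combination. *)
Lemma cone_conv s y (m : R) : cone [seq (x, 1) | x <- s] (y, m) ->
  m = 0 /\ y = 0 \/ 0 < m /\ hull s (m^-1 *: y).
Proof.
elim: s y m => [|a s IH] y m /=; first by case; left.
move=> [c c0 /IH /=]; rewrite [c *: 1]mulr1.
have sub : hull s `<=` hull (a :: s).
  by apply: sub_hull => x; rewrite inE => ->; rewrite orbT.
have ha : hull (a :: s) a by exact: mem_hull (mem_head _ _).
case=> [[/eqP]|[mc]].
  rewrite !subr_eq0 => /eqP mc /eqP; rewrite subr_eq0 => /eqP ->.
  have [c00|cn0] := eqVneq c 0; first by left; rewrite mc c00 scale0r.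
  right; rewrite scalerA mc mulVf // scale1r; split => //.
  by rewrite lt_neqAle eq_sym cn0.
move=> /sub h; right; have m0 : 0 < m by lra.
split => //; have -> : m^-1 *: y = ((m - c) / m) *: ((m - c)^-1 *: (y - c *: a))
    + (c / m) *: a.
  rewrite scalerA mulrAC divff ?gt_eqF // div1r scalerBr scalerA.
  by rewrite [m^-1 * c]mulrC subrK.
apply: conv_hull_convex => //.
- by rewrite divr_ge0 // ltW.
- by rewrite divr_ge0 // ltW.
- by rewrite -mulrDl subrK divff // gt_eqF.
Qed.

Lemma separation s x : ~ hull s x ->
  exists2 e, (forall y, y \in s -> ev e y <= 0) & 0 < ev e x.
Proof.
move=> hx; have [/cone_conv|[e es ex]] := farkas [seq (y, 1) | y <- s] (x, 1).
  case=> [[/eqP]|[_]]; first by rewrite oner_eq0.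
  by rewrite invr1 scale1r.
exists e; rewrite ?ev_pdot // => y ys; rewrite ev_pdot; apply: es.
by apply/mapP; exists y.
Qed.

(** Farkas' lemma for the tangent cone at [y], generated by the vectors [x - y]: a direction outside
    it is cut off by a functional supporting [s] at [y]. *)
Lemma feasible_direction s y z : hull s y ->
  (exists2 a : R, 0 < a & hull s (y + a *: z)) \/
  exists e, [/\ forall x, x \in s -> ev e x <= 0, ev e y = 0 & 0 < dot e.1 z].
Proof.
move=> hy.
have [h|[e es ez]] := farkas [seq (x - y, 0) | x <- s] (z, 0).
  (* With [m] the total weight, adding [m *: y] turns a combination of the [x - y] into one of the
     [x]. *)
  left; have [m] : exists m : R, cone [seq (x, 1) | x <- s] (z + m *: y, m).
    elim: s z h {hy} => [|a s IH] z /=.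
      by case=> ->; exists 0; rewrite scale0r addr0.
    move=> [c c0 h]; have [|m hm] := IH (z - c *: (a - y)).
      by move: h; congr cone; congr (_, _) => /=; rewrite scaler0 subr0.
    exists (m + c), c => //; suff -> : (z + (m + c) *: y, m + c) - c *: (a, 1) =
      (z - c *: (a - y) + m *: y, m) by [].
    congr (_, _) => /=; last by rewrite [c *: 1]mulr1 addrK.
    by coefwise; ring.
  case/cone_conv=> [[-> ]|[m0 h']].
    rewrite scale0r addr0 => ->; exists 1 => //.
    by rewrite scaler0 addr0.
  exists m^-1; first by rewrite invr_gt0.
  move: h'; rewrite scalerDr scalerA mulVf ?gt_eqF // scale1r.
  by rewrite addrC.
right; exists (e.1, - dot e.1 y); split.
- move=> x xs; have := es (x - y, 0); rewrite /pdot /ev /= mulr0 addr0.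
  rewrite dotBr; apply.
  by apply/mapP; exists x.
- by rewrite /ev subrr.
- by move: ez; rewrite /pdot /= mulr0 addr0.
Qed.

(** Subtracting [b.2 *: z] cancels the total weight of the combination, leaving a vector parallel to
    the affine hull. *)
Lemma cone_aff (A : set V) (s : seq (V * R)) (b : V * R) z :
  (forall a, a \in s -> exists p (c : R), aff_hull A p /\ a = c *: (p, 1)) ->
  aff_hull A z -> cone s b -> aff_hull A (z + (b.1 - b.2 *: z)).
Proof.
elim: s b => [|a s IH] b sA Az /=.
  by move=> ->; rewrite scale0r subrr addr0.
case=> d _ /IH /= h; have [p [c [Ap ac]]] := sA a (mem_head _ _).
have {}h : aff_hull A (z + (b.1 - d *: a.1 - (b.2 - d * a.2) *: z)).
  by apply: h => // u us; apply: sA; rewrite inE us orbT.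
have -> : z + (b.1 - b.2 *: z) =
    z + (b.1 - d *: a.1 - (b.2 - d * a.2) *: z) + (d * c) *: (p - z).
  by rewrite ac /= [c *: 1]mulr1; coefwise; ring.
by apply: affine_shift => //; exact: aff_hull_affine.
Qed.

(** The generators together with their negatives form a linear subspace as a cone, so the functional
    from Farkas' lemma must vanish on them. *)
Lemma aff_separation s x : ~ aff_hull [set` s] x ->
  exists2 e, (forall y, y \in s -> ev e y = 0) & 0 < ev e x.
Proof.
move=> hx; pose ls := [seq (y, 1) : V * R | y <- s].
have [h|[e es ex]] := farkas (ls ++ [seq - a | a <- ls]) (x, 1).
  case: s => [|z s] in hx ls h *.
    by move: h => /= [_ /eqP]; rewrite oner_eq0.
  case: hx; have -> : x = z + ((x, 1 : R).1 - (x, 1 : R).2 *: z).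
    by rewrite /= scale1r addrC subrK.
  apply: cone_aff h; last by apply: aff_hull_sub; exact: mem_head.
  move=> a; rewrite mem_cat => /orP[/mapP[p ps ->]|/mapP[_ /mapP[p ps ->] ->]].
    by exists p, 1; rewrite scale1r; split => //; apply: aff_hull_sub.
  by exists p, (-1); rewrite scaleN1r; split => //; apply: aff_hull_sub.
exists e; last by rewrite ev_pdot.
move=> y ys; have yl : (y, 1) \in ls by apply/mapP; exists y.
apply/eqP; rewrite ev_pdot eq_le es ?mem_cat ?yl //= -oppr_le0.
rewrite -[X in X <= 0]mulN1r -pdotZ scaleN1r es // mem_cat; apply/orP; right.
by apply/mapP; exists (y, 1).
Qed.

End Affine.

(** * Closedness of finite hulls and limits along segments *)

Section Topology.
Variable R : realType.
Notation V := (dsum R).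
Implicit Types (x y z v : V) (e : V * R) (s : seq V).

Lemma dot_le_norm x y : `|dot x y| <= `|x| * `|y|.
Proof.
rewrite -[`|x|]/(enorm x) -[`|y|]/(enorm y) /enorm -sqrtrM ?dot_ge0 //.
by rewrite -sqrtr_sqr ler_wsqrtr // dot_CauchySchwarz.
Qed.

Lemma closure_sub_hull (X : set V) s : X `<=` hull s -> closure X `<=` hull s.
Proof.
move=> Xs x cx; apply: contrapT => /separation[e es ex].
(* By Cauchy-Schwarz [e] stays positive on the ball of this radius; the added 1 avoids dividing by
   zero. *)
pose d := ev e x / (`|e.1| + 1).
have e1 : 0 < `|e.1| + 1 by rewrite ltr_wpDl.
have d0 : 0 < d by rewrite divr_gt0.
have [y [Xy]] : X `&` ball x d !=set0 by apply: cx; exact: nbhsx_ballx.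
rewrite -ball_normE /= => xy.
have le0 := ev_hull_le0 es (Xs y Xy).
have : ev e x - ev e y <= `|e.1| * `|x - y|.
  apply: le_trans (dot_le_norm _ _); apply: le_trans (ler_norm _).
  by rewrite evB.
rewrite ltr_pdivlMr // in xy.
have := normr_ge0 (x - y); lra.
Qed.

Lemma closure_segment (X : set V) x z :
  (forall a : R, 0 < a -> a <= 1 -> X (x + a *: z)) -> closure X x.
Proof.
move=> h B /nbhs_ballP[d /= d0 dB].
pose a := Num.min 1 (d / 2 / (`|z| + 1)).
have z1 : 0 < `|z| + 1 by rewrite ltr_wpDl.
have a0 : 0 < a by rewrite lt_min ltr01 /= !divr_gt0.
have a1 : a <= 1 by rewrite ge_min lexx.
exists (x + a *: z); split; first exact: h.
apply: dB; rewrite -ball_normE /= opprD addNKr normrN normrZ gtr0_norm //.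
have : a <= d / 2 / (`|z| + 1) by rewrite ge_min lexx orbT.
rewrite ler_pdivlMr // => h1.
have := normr_ge0 z; lra.
Qed.

End Topology.

(** * Affine independence, cardinality and affine bases *)

Section AffineIndependence.
Variable R : realType.
Notation V := (dsum R).
Implicit Types (x y z v : V) (e : V * R) (s : seq V).

Lemma aff_rangeP n (p : 'I_n -> V) x : aff_hull (range p) x ->
  exists2 c : 'I_n -> R, \sum_i c i = 1 & x = \sum_i c i *: p i.
Proof.
move=> [m [q [w [qp w1 ->]]]].
have /choice[f fE] : forall i, exists j, p j = q i.
  by move=> i; have [j _ <-] := qp i; exists j.
exists (fun j => \sum_(i | f i == j) w i).
  by rewrite -w1 (partition_big f xpredT).
rewrite (partition_big f xpredT) //=; apply: eq_bigr => j _.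
by rewrite scaler_suml; apply: eq_bigr => i /eqP <-; rewrite fE.
Qed.

Lemma aff_range_mem n (p : 'I_n -> V) i : aff_hull (range p) (p i).
Proof. by apply: aff_hull_sub; exists i. Qed.

(** With more points [p] than [q], the coefficient matrix has a left kernel vector, which is an
    affine dependence of the [p] since each row sums to 1. *)
Lemma aff_indep_card n m (p : 'I_n -> V) (q : 'I_m -> V) : aff_independent p ->
  (forall i, aff_hull (range q) (p i)) -> (n <= m)%N.
Proof.
move=> ip pq; rewrite leqNgt; apply/negP => mn.
have /choice[a aE] : forall i, exists a : 'I_m -> R,
    \sum_j a j = 1 /\ p i = \sum_j a j *: q j.
  by move=> i; have [a a1 aE] := aff_rangeP (pq i); exists a.
pose A := \matrix_(i, j) a i j.
have : kermx A != 0.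
  rewrite kermx_eq0 -row_leq_rank -ltnNge.
  exact: leq_ltn_trans (rank_leq_col A) mn.
case/rowV0Pn => w /sub_kermxP wA /eqP; apply; apply/rowP => i; rewrite mxE.
have wa j : \sum_i w 0 i * a i j = 0.
  by have /matrixP/(_ 0 j) := wA; rewrite !mxE; under eq_bigr do rewrite mxE.
apply: (ip (fun i => w 0 i)).
  under eq_bigr => u _ do rewrite -[w 0 u]mulr1 -(aE u).1 mulr_sumr.
  by rewrite exchange_big big1.
under eq_bigr => u _ do rewrite (aE u).2 scaler_sumr.
rewrite exchange_big big1 //= => j _.
by under eq_bigr do rewrite scalerA; rewrite -scaler_suml wa scale0r.
Qed.

Definition ext n v (p : 'I_n -> V) (i : 'I_n.+1) : V := oapp p v (unlift ord0 i).

Lemma ext0 n v (p : 'I_n -> V) : ext v p ord0 = v.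
Proof. by rewrite /ext unlift_none. Qed.

Lemma extS n v (p : 'I_n -> V) i : ext v p (lift ord0 i) = p i.
Proof. by rewrite /ext liftK. Qed.

Lemma extP n v (p : 'I_n -> V) (P : V -> Prop) :
  P v -> (forall i, P (p i)) -> forall i, P (ext v p i).
Proof. by move=> Pv Pp i; rewrite /ext; case: unlift => [j|] /=. Qed.

Lemma range_ext n v (p : 'I_n -> V) : range (ext v p) = v |` range p.
Proof.
apply/seteqP; split=> x /=.
  case=> i _ <-; rewrite /ext; case: unlift => [j|] /=; last by left.
  by right; exists j.
case=> [->|[j _ <-]]; first by exists ord0; rewrite ?ext0.
by exists (lift ord0 j); rewrite ?extS.
Qed.

Lemma ext_indep n v (p : 'I_n -> V) : aff_independent p ->
  ~ aff_hull (range p) v -> aff_independent (ext v p).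
Proof.
move=> ip hv w; rewrite !big_ord_recl ext0.
under [X in _ -> _ + X = _ -> _]eq_bigr do rewrite extS.
move=> w0 wp.
have wv0 : w ord0 = 0.
  apply: contrapT => /eqP wn0; apply: hv.
  exists n, p, (fun i => - w (lift ord0 i) / w ord0); split.
  - by move=> i; exists i.
  - rewrite -mulr_suml sumrN; move/eqP: w0; rewrite addrC addr_eq0 => /eqP ->.
    by rewrite opprK divff.
  - under eq_bigr do rewrite mulrC -scalerA scaleNr.
    rewrite -scaler_sumr sumrN; move/eqP: wp; rewrite addrC addr_eq0 => /eqP ->.
    by rewrite opprK scalerA mulVf // scale1r.
have wS := ip (fun i => w (lift ord0 i)).
move: w0 wp; rewrite wv0 scale0r !add0r => /wS/[apply] h i.
by case: (unliftP ord0 i) => [j ->|->].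
Qed.

Lemma aff_indep_full n (p q : 'I_n -> V) : aff_independent p ->
  (forall i, aff_hull (range q) (p i)) -> aff_hull (range q) `<=` aff_hull (range p).
Proof.
move=> ip pq x qx; apply: contrapT => /(ext_indep ip) h.
suff : (n.+1 <= n)%N by rewrite ltnn.
by apply: (aff_indep_card h (q := q)); apply: (extP (P := aff_hull (range q))).
Qed.

Lemma aff_basis s : exists n (p : 'I_n -> V),
  [/\ forall i, p i \in s, aff_independent p & [set` s] `<=` aff_hull (range p)].
Proof.
elim: s => [|a s [n [p [ps ip sp]]]].
  by exists 0%N, (fun=> 0); split => // [[]|w _ _ []].
have [ap|ap] := pselect (aff_hull (range p) a).
  exists n, p; split=> [i||x] //; first by rewrite inE ps orbT.
  by rewrite /= inE => /predU1P[->//|/sp].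
exists n.+1, (ext a p); split; last first.
- move=> x /=; rewrite inE range_ext => /predU1P[->|/sp].
    by apply: aff_hull_sub; left.
  by apply: aff_hullS => y py; apply: aff_hull_sub; right.
- exact: ext_indep.
- by apply: (extP (P := fun y => y \in a :: s)) => [|i]; rewrite inE ?eqxx // ps orbT.
Qed.

End AffineIndependence.

(** * Barycentric coordinates over a subfield *)

Section Rationality.
Variables (R : realType) (k : {pred R}).
Hypothesis hk : GRing.divring_closed k.
Notation V := (dsum R).
Implicit Types (x y z v : V) (e : V * R) (s : seq V).

HB.instance Definition _ := GRing.isDivringClosed.Build R k hk.

Definition kpoint x := (x : {poly R}) \is a polyOver k.

Lemma kpoint_comb (a b : R) x y : a \in k -> b \in k -> kpoint x -> kpoint y ->
  kpoint (a *: x + b *: y).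
Proof.
move=> ak bk /polyOverP xk /polyOverP yk; apply/polyOverP => i.
by rewrite coefD !coefZ rpredD // rpredM.
Qed.

Lemma dot_k x y : kpoint x -> kpoint y -> dot x y \in k.
Proof.
move=> /polyOverP xk /polyOverP yk.
by apply: rpred_sum => i _; rewrite rpredM.
Qed.

Lemma det_k n (M : 'M[R]_n) : (forall i j, M i j \in k) -> \det M \in k.
Proof.
move=> Mk; apply: rpred_sum => s _; rewrite rpredM ?rpred_sign //.
by apply: rpred_prod.
Qed.

Lemma adj_k n (M : 'M[R]_n) i j : (forall i j, M i j \in k) -> (\adj M) i j \in k.
Proof.
move=> Mk; rewrite mxE /cofactor rpredM ?rpred_sign //.
by apply: det_k => ? ?; rewrite !mxE.
Qed.

(* The barycentric coordinates solve a linear system whose matrix is the Gram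
   matrix of the homogenised points. *)
Lemma barycentric_k n (p : 'I_n -> V) (c : 'I_n -> R) : aff_independent p ->
  (forall i, kpoint (p i)) -> \sum_i c i = 1 -> kpoint (\sum_i c i *: p i) ->
  forall i, c i \in k.
Proof.
move=> ip pk c1 xk.
have pdot_sum (e : V * R) (w : 'I_n -> R) :
    pdot e (\sum_j w j *: (p j, 1)) = \sum_j w j * pdot e (p j, 1).
  rewrite (big_morph (pdot e) (pdotD e) (id1 := 0)).
    by apply: eq_bigr => j _; rewrite pdotZ.
  by rewrite -(scale0r 0) pdotZ mul0r.
have lift_sum (w : 'I_n -> R) :
    \sum_j w j *: (p j, 1) = (\sum_j w j *: p j, \sum_j w j).
  elim/big_rec3: _ => // j a b d _ ->.
  by congr (_, _) => /=; rewrite [w j *: 1]mulr1.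
pose G := \matrix_(i, j) pdot (p i, 1) (p j, 1).
have Gk i j : G i j \in k.
  by rewrite mxE rpredD ?dot_k //= mulr1 rpred1.
have Gu : G \in unitmx.
  (* A kernel vector gives a combination orthogonal to every homogenised point, hence to itself; it
     is zero by positivity, and its coefficients vanish by independence. *)
  rewrite -row_free_unit -kermx_eq0; apply/rowV0P => w /sub_kermxP wG.
  have wGj j : pdot (p j, 1) (\sum_i w 0 i *: (p i, 1)) = 0.
    have /matrixP/(_ 0 j) := wG; rewrite !mxE => wj.
    by rewrite pdot_sum -[RHS]wj; apply: eq_bigr => i _; rewrite mxE pdotC.
  have /eqP : pdot (\sum_i w 0 i *: (p i, 1)) (\sum_i w 0 i *: (p i, 1)) = 0.
    by rewrite pdot_sum big1 // => j _; rewrite pdotC wGj mulr0.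
  case: (eqVneq (\sum_i w 0 i *: ((p i, 1) : V * R)) 0) => [|/pdot_gt0 h]; last first.
    by rewrite gt_eqF.
  rewrite lift_sum => -[w0 w1] _; apply/rowP => i; rewrite mxE.
  exact: (ip (fun i => w 0 i)).
pose b := \row_j pdot (\sum_i c i *: (p i, 1)) (p j, 1).
have bk j : b 0 j \in k.
  by rewrite mxE lift_sum c1 rpredD ?dot_k //= mulr1 rpred1.
have cG : (\row_i c i) *m G = b.
  apply/rowP => j; rewrite !mxE pdotC pdot_sum.
  by apply: eq_bigr => i _; rewrite !mxE pdotC.
have cE : \row_i c i = b *m invmx G by rewrite -cG mulmxK.
move=> i; have /rowP/(_ i) := cE; rewrite mxE => ->; rewrite mxE.
(* Cramer's rule: adjugate and determinant have values in [k]. *)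
apply: rpred_sum => j _; rewrite rpredM // /invmx Gu mxE rpredM ?adj_k //.
by rewrite rpredV det_k.
Qed.

End Rationality.

(** * Separating functionals that cut out facets *)

Section Facets.
Variable R : realType.
Notation V := (dsum R).
Implicit Types (x y z v : V) (e g l : V * R) (s : seq V).

Lemma seq_argmin (f : V -> R) s : s != [::] ->
  exists2 x, x \in s & forall y, y \in s -> f x <= f y.
Proof.
elim: s => // a s IH _; have [->|/IH[x xs xmin]] := eqVneq s [::].
  by exists a; rewrite ?mem_head // => y; rewrite inE => /eqP ->.
have [ax|xa] := leP (f a) (f x).
  exists a; rewrite ?mem_head // => y; rewrite inE => /predU1P[->//|/xmin].
  exact: le_trans.
exists x; rewrite ?inE ?xs ?orbT // => y; rewrite inE => /predU1P[->|/xmin//].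
exact: ltW.
Qed.

Lemma count_lt (a b : pred V) s x : (forall y, y \in s -> a y -> b y) ->
  x \in s -> b x -> ~~ a x -> (count a s < count b s)%N.
Proof.
move=> ab xs bx ax; rewrite -(size_filter b) -(count_predC a) count_filter.
have -> : count (predI a b) s = count a s.
  by apply: eq_in_count => y ys /=; case: (boolP (a y)) => // /(ab y ys) ->.
rewrite -[X in (X < _)%N]addn0 ltn_add2l -has_count; apply/hasP.
by exists x; rewrite ?mem_filter ?bx.
Qed.

(* A separating functional maximising the number of generators on its zero set
   is rigid: rotating it about that zero set and [x] would make it hit one more
   generator. *)
Lemma rigid_separation s x : ~ hull s x ->
  exists e, [/\ forall y, y \in s -> ev e y <= 0, 0 < ev e x &
    forall l, (forall y, y \in s -> ev e y = 0 -> ev l y = 0) -> ev l x = 0 ->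
      forall y, y \in s -> ev l y = 0].
Proof.
move=> /separation[e es ex].
have [n] := ubnP (count (fun y => ev e y != 0) s).
elim: n e es ex => // n IH e es ex; rewrite ltnS => en.
have [h|] := pselect (forall l,
    (forall y, y \in s -> ev e y = 0 -> ev l y = 0) -> ev l x = 0 ->
    forall y, y \in s -> ev l y = 0); first by exists e.
move=> /existsNP[l /not_implyP[le /not_implyP[lx /existsNP[y /not_implyP[ys ly]]]]].
wlog ly0 : l le lx ly / 0 < ev l y => [wl|].
  have [ly0|ly0] := ltP 0 (ev l y); first exact: wl ly0.
  apply: (wl (- l)); rewrite ?evN ?lx ?oppr0 //.
  - by move=> z zs ez; rewrite evN le ?oppr0.
  - by move/eqP; rewrite oppr_eq0 => /eqP.
  - by rewrite oppr_gt0 lt_neqAle ly0 andbT; apply/eqP.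
have [|z] := @seq_argmin (fun z => - ev e z / ev l z) [seq z <- s | 0 < ev l z].
  by apply/eqP => h; have : y \in [::] by rewrite -h mem_filter ly0.
rewrite mem_filter => /andP[lz zs] zmin.
(* The smallest rotation at which a generator reaches the zero set: all generators stay on the
   nonpositive side and [z] becomes a new zero. *)
pose t := - ev e z / ev l z.
have t0 : 0 <= t by rewrite divr_ge0 ?oppr_ge0 ?es // ltW.
have E u : ev (e + t *: l) u = ev e u + t * ev l u by rewrite evD evZ.
apply: (IH (e + t *: l)) => [u us||].
- rewrite E; have := es u us; have [lu|lu] := ltP 0 (ev l u); last by nra.
  have := zmin u; rewrite mem_filter lu us => /(_ isT).
  by rewrite -/t ler_pdivlMr // => ? ?; lra.
- by rewrite E lx mulr0 addr0.
- apply: leq_trans en; apply: (@count_lt _ _ _ z) => //.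
  + move=> u us; apply: contraNN => /eqP eu.
    by rewrite E eu (le u us eu) mulr0 addr0.
  + by apply/eqP => ez; move: lz; rewrite (le z zs ez) ltxx.
  + by rewrite negbK E /t divfK ?subrr ?lt0r_neq0.
Qed.

Lemma ev_aff_range0 e n (p : 'I_n -> V) x : (forall i, ev e (p i) = 0) ->
  aff_hull (range p) x -> ev e x = 0.
Proof. by move=> ep; apply: ev_aff0 => _ [i _ <-]. Qed.

(** Rigidity forces the zeros of [e] among the generators, together with [x], to span the whole
    affine space, so a basis of these zeros has exactly [d] points. *)
Lemma separating_facet d (q : 'I_d.+1 -> V) s x : aff_independent q ->
  (forall i, hull s (q i)) -> [set` s] `<=` aff_hull (range q) ->
  aff_hull (range q) x -> ~ hull s x ->
  exists e (t : 'I_d -> V), [/\ forall y, y \in s -> ev e y <= 0, 0 < ev e x,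
    forall i, t i \in s, forall i, ev e (t i) = 0 & aff_independent t].
Proof.
move=> iq qs sq xq /rigid_separation[e [es ex rigid]]; exists e.
have [r [t [tT it Tt]]] := aff_basis [seq y <- s | ev e y == 0].
have te i : ev e (t i) = 0 by have := tT i; rewrite mem_filter => /andP[/eqP].
have ts i : t i \in s by have := tT i; rewrite mem_filter => /andP[].
have xt : ~ aff_hull (range t) x.
  by move=> /(ev_aff_range0 te) ex0; rewrite ex0 ltxx in ex.
have rd : (r.+1 <= d.+1)%N.
  apply: (aff_indep_card (ext_indep it xt) (q := q)).
  by apply: (extP (P := aff_hull (range q))) => // i; apply: sq; exact: ts.
have dr : (d.+1 <= r.+1)%N.
  apply: (aff_indep_card iq (q := ext x t)) => j; apply: contrapT.
  have -> : range (ext x t) = [set` x :: [seq t i | i : 'I_r]].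
    rewrite range_ext; apply/seteqP; split=> y /=; rewrite inE.
      by case=> [->|[i _ <-]]; rewrite ?eqxx // codom_f orbT.
    by move=> /predU1P[->|/mapP[i _ ->]]; [left|right; exists i].
  move=> /aff_separation[l lt lq].
  have ls y : y \in s -> ev l y = 0.
    apply: rigid; last by rewrite lt ?mem_head.
    move=> z zs ez; apply: (@ev_aff_range0 _ _ t).
      by move=> i; rewrite lt // inE codom_f orbT.
    by apply: Tt; rewrite /= mem_filter ez eqxx zs.
  have := ev_aff0 ls (conv_aff (qs j)); move/eqP; by rewrite gt_eqF.
have rE : r = d by apply/eqP; rewrite eqn_leq -ltnS rd -ltnS dr.
by subst r; exists t.
Qed.

End Facets.

(** * Normalising facet functionals over the subfield *)

Section RationalFacets.
Variables (R : realType) (k : {pred R}).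
Hypothesis hk : GRing.divring_closed k.
Notation V := (dsum R).
Implicit Types (x y z v : V) (e g l : V * R) (s : seq V).

Section Span.
Variables (d : nat) (q : 'I_d.+1 -> V).
Notation W := (aff_hull (range q)).

(** Only values at [k]-points of [W] are constrained: crossing points are computed from such
    values. *)
Definition rational e := forall y, W y -> kpoint k y -> ev e y \in k.

Lemma flat_full (t : 'I_d -> V) v : aff_independent t -> (forall i, W (t i)) ->
  W v -> ~ aff_hull (range t) v -> W `<=` aff_hull (range (ext v t)).
Proof.
move=> it Wt Wv tv; apply: aff_indep_full; first exact: ext_indep.
exact: (extP (P := W)).
Qed.

Lemma ext_aff_ev (t : 'I_d -> V) v e x : (forall i, ev e (t i) = 0) ->
  ev e v != 0 -> aff_hull (range (ext v t)) x ->
  exists c : 'I_d -> R, \sum_i c i + ev e x / ev e v = 1 /\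
    x = (ev e x / ev e v) *: v + \sum_i c i *: t i.
Proof.
move=> et ev0 /aff_rangeP[c].
rewrite !big_ord_recl ext0; under [X in _ -> _ = _ + X -> _]eq_bigr do rewrite extS.
move=> c1 xE; exists (fun i => c (lift ord0 i)).
suff -> : ev e x / ev e v = c ord0 by rewrite addrC.
have -> : ev e x = c ord0 * ev e v.
  have -> : x = \sum_i c i *: ext v t i.
    by rewrite big_ord_recl ext0; under eq_bigr do rewrite extS.
  rewrite ev_sum ?big_ord_recl // ext0.
  by rewrite big1 ?addr0 // => i _; rewrite extS et mulr0.
by rewrite mulfK.
Qed.

(** Up to sign the rescaled [e] is the barycentric coordinate at [v] in the basis formed by [v] and
    [t], and such coordinates of [k]-points lie in [k]. *)
Lemma rational_scale (s : seq V) e (t : 'I_d -> V) v :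
  [set` s] `<=` W -> (forall y, y \in s -> kpoint k y) ->
  (forall i, t i \in s) -> aff_independent t -> (forall i, ev e (t i) = 0) ->
  v \in s -> ev e v < 0 -> rational ((- ev e v)^-1 *: e).
Proof.
move=> sW sk ts it et vs ev0 y Wy yk.
have tv : ~ aff_hull (range t) v.
  by move=> /(ev_aff_range0 et) /eqP; rewrite lt_eqF.
have Wt i : W (t i) by apply: sW; exact: ts.
have := flat_full it Wt (sW v vs) tv Wy.
move=> /(ext_aff_ev et)[|c [c1 yE]]; first by rewrite lt_eqF.
pose c' i := oapp c (ev e y / ev e v) (unlift ord0 i).
have c'0 : c' ord0 = ev e y / ev e v by rewrite /c' unlift_none.
have c'S i : c' (lift ord0 i) = c i by rewrite /c' liftK.
have c'1 : \sum_i c' i = 1.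
  by rewrite big_ord_recl c'0; under eq_bigr do rewrite c'S; rewrite addrC.
have ye : y = \sum_i c' i *: ext v t i.
  rewrite big_ord_recl c'0 ext0; under eq_bigr do rewrite c'S extS.
  exact: yE.
have : c' ord0 \in k.
  apply: (barycentric_k hk (ext_indep it tv)) => //; last by rewrite -ye.
  by apply: (extP (P := kpoint k)) => [|i]; apply: sk.
rewrite c'0 => h; rewrite evZ invrN mulNr mulrC rpredN //.
Qed.

End Span.
End RationalFacets.

(** * Half-space descriptions of full-dimensional hulls over the subfield *)

Section Span.
Variables (R : realType) (k : {pred R}).
Hypothesis hk : GRing.divring_closed k.
Notation V := (dsum R).
Implicit Types (x y z v b : V) (e g l : V * R) (s : seq V).

Variables (d : nat) (q : 'I_d.+1 -> V).
Hypothesis iq : aff_independent q.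
Notation W := (aff_hull (range q)).

Definition ksubset s := forall y, y \in s -> kpoint k y /\ W y.

Lemma ksubsetW s : ksubset s -> hull s `<=` W.
Proof.
move=> sk; apply: hull_min => [x /sk[]//|x y a b Wx Wy _ _].
exact: aff_hull_comb.
Qed.

Lemma ksubset_cons v s : kpoint k v -> W v -> ksubset s -> ksubset (v :: s).
Proof. by move=> kv Wv sk y; rewrite inE => /predU1P[->|/sk]. Qed.

Lemma ksubset_cat s t : ksubset s -> ksubset t -> ksubset (s ++ t).
Proof. by move=> sk tk y; rewrite mem_cat => /orP[/sk|/tk]. Qed.

Lemma exists_neg s e x : (forall i, hull s (q i)) -> W x ->
  (forall y, y \in s -> ev e y <= 0) -> ev e x != 0 ->
  exists2 y, y \in s & ev e y < 0.
Proof.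
move=> qs Wx es ex; apply: contrapT => h; move/eqP: ex; apply.
apply: (ev_aff_range0 (p := q)) => // i; apply: (ev_aff0 _ (conv_aff (qs i))) => y /= ys.
apply/eqP; rewrite eq_le es //= leNgt; apply/negP => ey; apply: h; by exists y.
Qed.

Lemma rational_facet s x : ksubset s -> (forall i, hull s (q i)) -> W x ->
  ~ hull s x ->
  exists e (t : 'I_d -> V), [/\ forall y, y \in s -> ev e y <= 0, 0 < ev e x,
    (forall i, t i \in s) /\ (forall i, ev e (t i) = 0), aff_independent t
    & rational k q e].
Proof.
move=> sk qs Wx sx.
have sW : [set` s] `<=` W by move=> y /sk[].
have [e [t [es ex ts te it]]] := separating_facet iq qs sW Wx sx.
have [|v vs ev0] := exists_neg qs Wx es; first by rewrite gt_eqF.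
have c0 : 0 < (- ev e v)^-1 by rewrite invr_gt0 oppr_gt0.
exists ((- ev e v)^-1 *: e), t; split=> // [y ys|||].
- by rewrite evZ pmulr_rle0 ?es.
- by rewrite evZ pmulr_rgt0.
- by split=> // i; rewrite evZ te mulr0.
- by apply: (rational_scale hk (s := s) (t := t)) => // y /sk[].
Qed.

Lemma facet_list s : ksubset s -> (forall i, hull s (q i)) ->
  exists G : seq (V * R), [/\ forall e, e \in G -> rational k q e,
    forall e, e \in G -> forall y, y \in s -> ev e y <= 0
    & forall x, W x -> (forall e, e \in G -> ev e x <= 0) -> hull s x].
Proof.
move=> sk qs.
pose facet_on (T : seq V) e := [/\ forall y, y \in s -> ev e y <= 0,
  rational k q e, T = [seq y <- s | ev e y == 0],
  exists2 y, y \in s & ev e y < 0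
  & exists t : 'I_d -> V, [/\ forall i, t i \in s, forall i, ev e (t i) = 0
    & aff_independent t]].
(* If no facet functional has zero set [T], the default is 0, which is rational and nowhere
   positive. *)
have /choice[f fP] : forall T, exists e, [/\ forall y, y \in s -> ev e y <= 0,
    rational k q e & (exists e', facet_on T e') -> facet_on T e].
  move=> T; have [[e h]|h] := pselect (exists e', facet_on T e').
    by exists e; case: (h) => *; split.
  exists 0; split=> // [y _|y _ _].
    by rewrite -(scale0r 0) evZ mul0r.
  by rewrite -(scale0r 0) evZ mul0r; have [] := hk => k1 kB _; rewrite -(subrr 1) kB.
(* Up to a positive factor a facet functional is determined on [W] by its zeros
   in [s], so one functional per mask of [s] suffices. *)
exists [seq f (mask m s) | m : (size s).-tuple bool]; split.
- by move=> e /codomP[m ->]; case: (fP (mask m s)).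
- by move=> e /codomP[m ->]; case: (fP (mask m s)).
move=> x Wx xG; apply: contrapT => sx.
have [e [t [es ex [ts te] it re]]] := rational_facet sk qs Wx sx.
have [|v vs ev0] := exists_neg qs Wx es; first by rewrite gt_eqF.
pose m : (size s).-tuple bool := map_tuple (fun y => ev e y == 0) (in_tuple s).
have mE : mask m s = [seq y <- s | ev e y == 0] by rewrite filter_mask.
have [fs rf] := fP (mask m s).
case; first by exists e; split=> //; [exists v|exists t].
move=> _ _ fE _ _; set g := f _ in fs fE *.
have gE y : y \in s -> (ev g y == 0) = (ev e y == 0).
  move=> ys; apply/idP/idP => h.
    have : y \in mask m s by rewrite fE mem_filter h.
    by rewrite mE mem_filter => /andP[].
  have : y \in mask m s by rewrite mE mem_filter h.
  by rewrite fE mem_filter => /andP[].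
have gt i : ev g (t i) = 0 by apply/eqP; rewrite gE ?te.
have gv : ev g v < 0 by rewrite lt_neqAle fs // gE // lt_eqF.
have tv : ~ aff_hull (range t) v.
  by move=> /(ev_aff_range0 te) /eqP; rewrite lt_eqF.
have sW : [set` s] `<=` W by move=> y /sk[].
have Wt i : W (t i) by apply: sW; exact: ts.
have xtv : aff_hull (range (ext v t)) x by apply: flat_full Wx => //; exact: sW.
(* Both functionals vanish on [t]; scaled to agree at [v], they agree on the affine span [W]. *)
have /eqP : ev (ev e v *: g - ev g v *: e) x = 0.
  apply: ev_aff_range0 xtv => i.
  apply: (extP (P := fun y => ev _ y = 0)) => [|{}i]; rewrite evD evN !evZ.
    by rewrite mulrC subrr.
  by rewrite te gt !mulr0 subrr.
rewrite evD evN !evZ subr_eq0 => /eqP h.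
have : 0 < ev g x by rewrite -(nmulr_rlt0 _ ev0) h nmulr_rlt0.
apply/negP; rewrite -leNgt; apply: xG; exact: codom_f.
Qed.

End Span.

(** * Crossing points and half-space sections of a hull *)

Section Crossing.
Variable R : realType.
Notation V := (dsum R).
Implicit Types (x y z v b : V) (e g l : V * R) (s : seq V).

(* The point where the segment from [v] to [b] meets the hyperplane [g = 0];
   meaningful only when [g b <= 0 < g v]. *)
Definition crossing g v b : V :=
  (ev g v / (ev g v - ev g b)) *: b + (- ev g b / (ev g v - ev g b)) *: v.

Lemma crossingP g v b : 0 < ev g v -> ev g b <= 0 ->
  exists a c : R, [/\ 0 < a, 0 <= c, a + c = 1,
    crossing g v b = a *: b + c *: v & ev g (crossing g v b) = 0].
Proof.
move=> gv gb; have h : 0 < ev g v - ev g b by rewrite subr_gt0 (le_lt_trans gb).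
exists (ev g v / (ev g v - ev g b)), (- ev g b / (ev g v - ev g b)).
have E : ev g v / (ev g v - ev g b) + - ev g b / (ev g v - ev g b) = 1.
  by rewrite -mulrDl divff // gt_eqF.
split=> //; first by rewrite divr_gt0.
  by rewrite divr_ge0 ?oppr_ge0 // ltW.
rewrite /crossing ev_comb //; field; by rewrite gt_eqF.
Qed.

Lemma crossing_id g v b : 0 < ev g v -> ev g b = 0 -> crossing g v b = b.
Proof.
move=> gv gb; rewrite /crossing gb subr0 divff ?gt_eqF // oppr0 mul0r.
by rewrite scale0r addr0 scale1r.
Qed.

Lemma before_crossing g v b (a c : R) : 0 < ev g v -> ev g b <= 0 ->
  0 <= a -> 0 <= c -> a + c = 1 -> ev g (a *: v + c *: b) <= 0 ->
  exists r : R, [/\ 0 <= r, r <= 1 &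
    a *: v + c *: b = r *: crossing g v b + (1 - r) *: b].
Proof.
move=> gv gb a0 c0 ac; rewrite ev_comb // => gx.
have [r1 [r2 [r10 r20 r12 zE]]] := crossingP gv gb.
rewrite {1}zE ev_comb // zE => gz.
have r1E : r1 = 1 - r2 by lra.
have cE : c = 1 - a by lra.
subst r1 c; have [r2z|r2n] := eqVneq r2 0.
  subst r2; exists 0; split=> //; have -> : a = 0 by nra.
  by rewrite !subr0 !scale0r !scale1r !add0r.
have r2p : 0 < r2 by rewrite lt_neqAle eq_sym r2n.
exists (a / r2); split; first by rewrite divr_ge0.
  by rewrite ler_pdivrMr // mul1r; nra.
by coefwise; field.
Qed.

Lemma after_crossing g v b (a c : R) : 0 < ev g v -> ev g b <= 0 ->
  0 <= a -> 0 <= c -> a + c = 1 -> 0 <= ev g (a *: v + c *: b) ->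
  exists r : R, [/\ 0 <= r, r <= 1 &
    a *: v + c *: b = (1 - r) *: v + r *: crossing g v b].
Proof.
move=> gv gb a0 c0 ac; rewrite ev_comb // => gx.
have [r1 [r2 [r10 r20 r12 zE]]] := crossingP gv gb.
rewrite {1}zE ev_comb // zE => gz.
have r2E : r2 = 1 - r1 by lra.
have aE : a = 1 - c by lra.
subst r2 a; exists (c / r1); split; first by rewrite divr_ge0 // ltW.
  by rewrite ler_pdivrMr // mul1r; nra.
by coefwise; field; rewrite gt_eqF.
Qed.

(** [crossing g v] is a projective map, hence sends segments to segments; the weights are rescaled
    by the denominators and normalised by [S]. *)
Lemma crossing_convexr g v (D : set V) : 0 < ev g v -> convex_set D ->
  convex_set [set b | ev g b <= 0 /\ D (crossing g v b)].
Proof.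
move=> gv cD x y a c [gx Dx] [gy Dy] a0 c0 ac; split.
  by rewrite ev_comb //; nra.
have hx : 0 < ev g v - ev g x by lra.
have hy : 0 < ev g v - ev g y by lra.
pose S := a * (ev g v - ev g x) + c * (ev g v - ev g y).
have SE : ev g v - ev g (a *: x + c *: y) = S.
  by rewrite ev_comb // /S -[X in X - _ = _]mul1r -ac; ring.
have S0 : 0 < S by rewrite -SE ev_comb //; nra.
have -> : crossing g v (a *: x + c *: y) =
  (a * (ev g v - ev g x) / S) *: crossing g v x +
  (c * (ev g v - ev g y) / S) *: crossing g v y.
  rewrite /crossing SE ev_comb //; have -> : c = 1 - a by lra.
  by coefwise; field; rewrite !gt_eqF.
apply: cD => //.
- by rewrite divr_ge0 ?mulr_ge0 // ltW.
- by rewrite divr_ge0 ?mulr_ge0 // ltW.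
- by rewrite -mulrDl divff // gt_eqF.
Qed.

(** The same projectivity in the other endpoint. The guard excludes the case where both values of
    [g] are zero and the quotients in [crossing] degenerate. *)
Lemma crossing_convexl g b (D : set V) : ev g b <= 0 -> convex_set D ->
  convex_set [set v | 0 <= ev g v /\
    (0 < ev g v - ev g b -> D (crossing g v b))].
Proof.
move=> gb cD x y a c [gx Dx] [gy Dy] a0 c0 ac; split.
  by rewrite ev_comb //; nra.
pose S := a * (ev g x - ev g b) + c * (ev g y - ev g b).
have SE : ev g (a *: x + c *: y) - ev g b = S.
  by rewrite ev_comb // /S -[X in _ - X = _]mul1r -ac; ring.
rewrite SE => S0.
have [hx|hx] := leP (ev g x - ev g b) 0.
  have gx0 : ev g x = 0 by lra.
  have gb0 : ev g b = 0 by lra.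
  have hy : 0 < ev g y by move: S0; rewrite /S gx0 gb0; nra.
  have -> : crossing g (a *: x + c *: y) b = crossing g y b.
    by rewrite !crossing_id //; move: S0; rewrite -SE gb0 subr0.
  by apply: Dy; rewrite gb0 subr0.
have [hy|hy] := leP (ev g y - ev g b) 0.
  have gy0 : ev g y = 0 by lra.
  have gb0 : ev g b = 0 by lra.
  have -> : crossing g (a *: x + c *: y) b = crossing g x b.
    rewrite !crossing_id //; first by move: hx; rewrite gb0 subr0.
    by move: S0; rewrite -SE gb0 subr0.
  exact: Dx.
have -> : crossing g (a *: x + c *: y) b =
  (a * (ev g x - ev g b) / S) *: crossing g x b +
  (c * (ev g y - ev g b) / S) *: crossing g y b.
  rewrite /crossing SE ev_comb //.
  by coefwise; field; rewrite !gt_eqF.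
apply: cD => //.
- exact: Dx.
- exact: Dy.
- by rewrite divr_ge0 ?mulr_ge0 // ltW.
- by rewrite divr_ge0 ?mulr_ge0 // ltW.
- by rewrite -mulrDl divff // gt_eqF.
Qed.

Definition cut g s := [seq y <- s | ev g y <= 0] ++
  [seq crossing g v b | v <- [seq v <- s | 0 < ev g v],
                        b <- [seq b <- s | ev g b <= 0]].

Lemma mem_cut g s x : x \in cut g s -> hull s x /\ ev g x <= 0.
Proof.
rewrite mem_cat => /orP[|/allpairsP[[v b] /=]].
  by rewrite mem_filter => /andP[gx xs]; split=> //; exact: mem_hull.
rewrite !mem_filter => -[/andP[gv vs] /andP[gb bs] ->].
have [a [c [a0 c0 ac -> ->]]] := crossingP gv gb; split=> //.
by apply: conv_hull_convex => //; [exact: mem_hull..|exact: ltW].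
Qed.

(** The union of [A] and [B] below is convex and contains [s]; as [g] is positive on [A] and [B]
    lies in [D], its part in the half-space lies in [D]. *)
Lemma hull_cut g s x : hull s x -> ev g x <= 0 -> hull (cut g s) x.
Proof.
set D := hull (cut g s) => sx gx; have cD : convex_set D by exact: conv_hull_convex.
pose B := [set b | [/\ ev g b <= 0, D b &
  forall v, v \in s -> 0 < ev g v -> D (crossing g v b)]].
have cB : convex_set B.
  move=> y z a c [gy Dy yB] [gz Dz zB] a0 c0 ac; split.
  - by rewrite ev_comb //; nra.
  - exact: cD.
  move=> v vs gv; have [] // := @crossing_convexr g v D gv cD y z a c _ _ a0 c0 ac.
    by split=> //; exact: yB.
  by split=> //; exact: zB.
pose A := [set a | 0 < ev g a /\ forall b, B b -> D (crossing g a b)].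
have mixA a y (b c : R) : 0 <= ev g a -> (forall b, B b -> 0 < ev g a - ev g b -> D (crossing g a b)) ->
    0 <= ev g y -> (forall b, B b -> 0 < ev g y - ev g b -> D (crossing g y b)) ->
    0 <= b -> 0 <= c -> b + c = 1 -> 0 < ev g (b *: a + c *: y) -> A (b *: a + c *: y).
  move=> ga Da gy Dy b0 c0 bc gay; split=> // u Bu.
  have [gu _ _] := Bu.
  have [] := @crossing_convexl g u D gu cD a y b c _ _ b0 c0 bc.
  - by split=> //; exact: Da.
  - by split=> //; exact: Dy.
  by move=> _; apply; lra.
(* The segment is split at its crossing [z], itself in [B]: on the near side of [b] convexity of [B]
   applies, on the side of [a] convexity of the crossing condition. *)
have AB a b t r : A a -> B b -> 0 <= t -> 0 <= r -> t + r = 1 ->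
    (A `|` B) (t *: a + r *: b).
  move=> [ga aA] Bb t0 r0 tr; have [gb Db bB] := Bb.
  pose z := crossing g a b.
  have Dz : D z by apply: aA.
  have [_ [_ [_ _ _ _ gz]]] := crossingP ga gb; rewrite -/z in gz.
  have Bz : B z.
    split=> //; first by rewrite gz.
    by move=> v vs gv; rewrite crossing_id // gz.
  have [gx0|gx0] := leP (ev g (t *: a + r *: b)) 0.
    right; have [u [u0 u1 ->]] := before_crossing ga gb t0 r0 tr gx0.
    by apply: cB => //; lra.
  left; have [c [c0 c1 E]] := after_crossing ga gb t0 r0 tr (ltW gx0).
  rewrite E; apply: mixA.
  - exact: ltW.
  - by move=> u Bu _; apply: aA.
  - by rewrite gz.
  - move=> u Bu gu; have [gu' Du _] := Bu.
    rewrite /crossing gz sub0r mul0r scale0r add0r divff ?scale1r //.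
    by rewrite oppr_eq0; apply/eqP => gu0; move: gu; rewrite gz gu0 subrr ltxx.
  - by lra.
  - by [].
  - by lra.
  - by rewrite -E.
have cAB : convex_set (A `|` B).
  move=> y z a c [Ay|By] [Az|Bz] a0 c0 ac.
  - left; have [gy yA] := Ay; have [gz zA] := Az.
    apply: mixA => //; try exact: ltW.
      by move=> u Bu _; apply: yA.
      by move=> u Bu _; apply: zA.
    have [a00|an] := eqVneq a 0.
      by rewrite ev_comb // a00 mul0r add0r mulr_gt0 //; lra.
    have gay : 0 < a * ev g y by rewrite mulr_gt0 // lt_neqAle eq_sym an.
    have gcz : 0 <= c * ev g z by rewrite mulr_ge0 // ltW.
    by rewrite ev_comb //; lra.
  - exact: AB.
  - by rewrite addrC; apply: AB => //; rewrite addrC.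
  - by right; apply: cB.
have sAB y : y \in s -> (A `|` B) y.
  have sB b : b \in s -> ev g b <= 0 -> B b.
    move=> bs gb; split=> //.
      by apply: mem_hull; rewrite mem_cat mem_filter gb bs.
    move=> v vs gv; apply: mem_hull; rewrite mem_cat; apply/orP; right.
    by apply/allpairsP; exists (v, b); rewrite !mem_filter gv gb vs bs.
  move=> ys; have [gy|gy] := leP (ev g y) 0; first by right; exact: sB.
  by left; split=> // b [gb Db]; apply.
have [[gx']|[]//] := hull_min sAB cAB sx.
by rewrite ltNge gx in gx'.
Qed.

End Crossing.

(** * Pyramids obtained by adding one point to a hull *)

Section Hulls.
Variable R : realType.
Notation V := (dsum R).
Implicit Types (x y z v b : V) (e g l : V * R) (s t : seq V).

(** When [c = 0] the point [y] is arbitrary, which covers an empty [s]. *)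
Lemma hull_cons v s x : hull (v :: s) x -> exists (a c : R) (y : V),
  [/\ 0 <= a, 0 <= c, a + c = 1, x = a *: v + c *: y & c != 0 -> hull s y].
Proof.
move: x; apply: hull_min => [x|x1 x2 b1 b2].
  rewrite inE => /predU1P[->|xs].
    exists 1, 0, 0; rewrite scale1r scaler0 !addr0 ler01 lexx; split=> //.
    by rewrite eqxx.
  exists 0, 1, x; rewrite scale0r scale1r !add0r ler01 lexx; split=> //.
  by move=> _; exact: mem_hull.
move=> [a1 [c1 [y1 [a10 c10 ac1 -> h1]]]] [a2 [c2 [y2 [a20 c20 ac2 -> h2]]]].
move=> b10 b20 bb; pose c := b1 * c1 + b2 * c2.
have b1c1 : 0 <= b1 * c1 by rewrite mulr_ge0.
have b2c2 : 0 <= b2 * c2 by rewrite mulr_ge0.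
have c0 : 0 <= c by rewrite addr_ge0.
exists (b1 * a1 + b2 * a2), c, ((b1 * c1 / c) *: y1 + (b2 * c2 / c) *: y2).
split=> //; first by rewrite addr_ge0 ?mulr_ge0.
- by rewrite /c addrACA -!mulrDr ac1 ac2 !mulr1.
- have [cz|cn] := eqVneq c 0.
    rewrite cz scale0r addr0 !scalerDr !scalerA.
    have -> : b1 * c1 = 0 by apply/eqP; rewrite eq_le b1c1 andbT; rewrite /c in cz; lra.
    have -> : b2 * c2 = 0 by apply/eqP; rewrite eq_le b2c2 andbT; rewrite /c in cz; lra.
    by rewrite !scale0r !addr0 scalerDl.
  by coefwise; field.
move=> cn; have [z1|n1] := eqVneq (b1 * c1) 0.
  have c2E : b2 * c2 = c by rewrite /c z1 add0r.
  rewrite z1 c2E mul0r scale0r add0r divff // scale1r; apply: h2.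
  by apply: contraNneq cn => c20'; rewrite -c2E c20' mulr0.
have [z2|n2] := eqVneq (b2 * c2) 0.
  have c1E : b1 * c1 = c by rewrite /c z2 addr0.
  rewrite z2 c1E mul0r scale0r addr0 divff // scale1r; apply: h1.
  by apply: contraNneq cn => c10'; rewrite -c1E c10' mulr0.
apply: conv_hull_convex.
- by apply: h1; move: n1; rewrite mulf_eq0 negb_or => /andP[].
- by apply: h2; move: n2; rewrite mulf_eq0 negb_or => /andP[].
- by rewrite divr_ge0.
- by rewrite divr_ge0.
- by rewrite -mulrDl divff.
Qed.

Lemma hull_sub_hull s t : (forall y, y \in s -> hull t y) -> hull s `<=` hull t.
Proof. by move=> st; apply: hull_min => //; exact: conv_hull_convex. Qed.

(** Going from [p] towards [v], the last point inside [hull s] cannot be moved further, so some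
    functional supports [s] there and is positive at [v]. *)
Lemma first_point s v p : ~ hull s v -> hull s p -> exists (a c : R) (y : V),
  [/\ 0 <= a, 0 <= c, a + c = 1, y = a *: v + c *: p & hull s y] /\
  exists e, [/\ forall z, z \in s -> ev e z <= 0, ev e y = 0 & 0 < ev e v].
Proof.
move=> sv sp.
pose A := [set a : R | [/\ 0 <= a, a <= 1 & hull s (a *: v + (1 - a) *: p)]].
have A0 : A 0 by split=> //; rewrite scale0r subr0 scale1r add0r.
have supA : has_sup A by split; [exists 0|exists 1 => a []].
pose a := sup A.
have Aa (t : R) : A t -> t <= a by move=> At; apply: sup_upper_bound.
have a0 : 0 <= a by exact: Aa.
have a1 : a <= 1 by apply: sup_le_ub; [exists 0|move=> t []].
pose y := a *: v + (1 - a) *: p.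
have sy : hull s y.
  (* The supremum is attained: a functional separating [y] would still be positive slightly before
     [y]. *)
  apply: contrapT => /separation[e es ey].
  pose m := ev e v - ev e p.
  have m1 : 0 < `|m| + 1 by rewrite ltr_wpDl.
  pose d := ev e y / (`|m| + 1).
  have d0 : 0 < d by rewrite divr_gt0.
  have [t At at_] := sup_adherent d0 supA.
  have ta := Aa t At; have [t0 t1 /(ev_hull_le0 es)] := At.
  rewrite ev_comb ?subrKC //; apply/negP; rewrite -ltNge.
  have : ev e y = a * ev e v + (1 - a) * ev e p by rewrite ev_comb ?subrKC.
  have : (a - t) * m <= (a - t) * `|m| by rewrite ler_wpM2l ?subr_ge0 ?ler_norm.
  have : (a - t) * (`|m| + 1) < ev e y.
    by rewrite -ltr_pdivlMr // ltrBlDr -ltrBlDl.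
  by rewrite /m; have := normr_ge0 m; nra.
exists a, (1 - a), y; split; first by rewrite subr_ge0 a1 subrKC.
have an1 : a != 1.
  by apply/eqP => aE; apply: sv; move: sy; rewrite /y aE subrr scale0r addr0 scale1r.
have a1' : a < 1 by rewrite lt_neqAle an1.
have [[t t0 ht]|[e [es ey ez]]] := feasible_direction (v - y) sy; last first.
  by exists e; split=> //; move: ez; rewrite -evB ey subr0.
pose t' := Num.min 1 t.
have t'0 : 0 < t' by rewrite lt_min ltr01.
have : A (a + t' * (1 - a)).
  have t'1 : t' <= 1 by rewrite ge_min lexx.
  have t't : t' <= t by rewrite ge_min lexx orbT.
  split; first by nra.
    by nra.
  have -> : (a + t' * (1 - a)) *: v + (1 - (a + t' * (1 - a))) *: p =
      (t' / t) *: (y + t *: (v - y)) + (1 - t' / t) *: y.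
    by rewrite /y; coefwise; field; rewrite gt_eqF.
  have tt : t' / t <= 1 by rewrite ler_pdivrMr ?mul1r.
  apply: conv_hull_convex => //; rewrite ?subr_ge0 ?subrKC //.
  by rewrite divr_ge0 // ltW.
move=> /Aa; rewrite gerDl leNgt mulr_gt0 // subr_gt0 //.
Qed.

(** Nothing is added where [e] is nonpositive, so the added part lies above the hyperplane and its
    closure is the pyramid with apex [v] over the face [e = 0]; the points [p] give the
    dimensions. *)
Lemma pyramidal_step n (p : 'I_n -> V) s v e :
  (forall y, y \in s -> ev e y <= 0) -> 0 < ev e v ->
  (forall x, hull (v :: s) x -> ev e x <= 0 -> hull s x) ->
  aff_independent p -> (forall i, hull s (p i)) -> (forall i, ev e (p i) = 0) ->
  hull s `<=` aff_hull (range (ext v p)) ->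
  pyramidal_extension (hull s) (hull (v :: s)).
Proof.
move=> es evp cutE ip sp ep sW.
have sQ : hull s `<=` hull (v :: s).
  by apply: sub_hull => x; rewrite inE => ->; rewrite orbT.
have Qv : hull (v :: s) v by apply: mem_hull; exact: mem_head.
pose T := [seq y <- s | ev e y == 0].
have Ts : hull T `<=` hull s by apply: sub_hull => x; rewrite mem_filter => /andP[].
have Te x : hull T x -> ev e x = 0.
  move=> /conv_aff; apply: ev_aff0 => y /=; rewrite mem_filter.
  by move=> /andP[/eqP].
have eT x : hull s x -> ev e x = 0 -> hull T x.
  move=> sx ex; have := conv_face es sx ex; apply: conv_hullS => y [/= ys ey].
  by rewrite mem_filter ey eqxx ys.
have DE : closure (hull (v :: s) `\` hull s) = hull (v :: T).
  apply/seteqP; split.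
    apply: closure_sub_hull => x [Qx sx].
    have ex : 0 < ev e x by rewrite ltNge; apply/negP => /(cutE _ Qx).
    have [a [c [y [a0 c0 ac xE hy]]]] := hull_cons Qx.
    have Dv : hull (v :: T) v by apply: mem_hull; exact: mem_head.
    have [cz|cn] := eqVneq c 0.
      by move: ac; rewrite xE cz addr0 scale0r addr0 => ->; rewrite scale1r.
    have sy := hy cn; have ey := ev_hull_le0 es sy.
    have [r1 [r2 [r10 r20 r12 zE ez]]] := crossingP evp ey.
    have ex' := ltW ex; rewrite xE in ex'.
    have [r [r0 r1' xzE]] := after_crossing evp ey a0 c0 ac ex'.
    rewrite xE xzE; set z := crossing e v y in zE ez *.
    have Qz : hull (v :: s) z.
      by rewrite zE; apply: conv_hull_convex => //; [exact: sQ|exact: ltW].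
    have Tz : hull T z by apply: eT => //; apply: cutE => //; rewrite ez.
    apply: conv_hull_convex => //; rewrite ?subr_ge0 ?subrK //.
    by apply: sub_hull Tz => u; rewrite inE => ->; rewrite orbT.
  move=> x /hull_cons[a [c [y [a0 c0 ac xE hy]]]].
  have Qs u : hull (v :: s) u -> 0 < ev e u -> (hull (v :: s) `\` hull s) u.
    by move=> Qu eu; split=> // /(ev_hull_le0 es); rewrite leNgt eu.
  have [cz|cn] := eqVneq c 0.
    move: ac; rewrite xE cz addr0 scale0r addr0 => ->; rewrite scale1r.
    by apply: subset_closure; apply: Qs.
  have Ty := hy cn; have Qy := sQ _ (Ts _ Ty).
  have [az|an] := eqVneq a 0; last first.
    apply: subset_closure; apply: Qs; rewrite xE; first exact: conv_hull_convex.
    by rewrite ev_comb // (Te y) // mulr0 addr0 mulr_gt0 // lt_neqAle eq_sym an.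
  move: ac; rewrite xE az add0r scale0r add0r => ->; rewrite scale1r.
  (* A base point is the limit of points moved slightly towards [v], where [e] is positive. *)
  apply: (@closure_segment _ _ _ (v - y)) => r r0 r1.
  have -> : y + r *: (v - y) = r *: v + (1 - r) *: y by coefwise; ring.
  have r1' : 0 <= 1 - r by rewrite subr_ge0.
  apply: Qs; first by apply: conv_hull_convex => //; rewrite ?subrKC // ltW.
  by rewrite ev_comb ?subrKC // (Te y) // mulr0 addr0 mulr_gt0.
have FE : hull (v :: T) `&` hull s = hull T.
  apply/seteqP; split=> [x [Dx sx]|x Tx]; last first.
    split; last exact: Ts.
    by apply: sub_hull Tx => u; rewrite inE => ->; rewrite orbT.
  apply: eT => //; apply/eqP; rewrite eq_le (ev_hull_le0 es sx) /=.
  rewrite -oppr_le0 -evN; apply: ev_hull_le0 Dx => y; rewrite inE evN oppr_le0.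
  by move=> /predU1P[->|/mem_hull/Te->//]; exact: ltW.
have pv : ~ aff_hull (range p) v.
  by move=> /(ev_aff_range0 ep) ev0; rewrite ev0 ltxx in evp.
rewrite /pyramidal_extension DE FE; split=> //.
  exists (hull T); first by exists [set` T]; first exact: finite_seq.
  exists v.
    move=> h; suff ev0 : ev e v = 0 by rewrite ev0 ltxx in evp.
    by apply: ev_aff0 h; exact: Te.
  apply/seteqP; split.
    apply: hull_min; last exact: conv_hull_convex.
    move=> x; rewrite inE => /predU1P[->|xT]; apply: conv_hull_sub; first by right.
    by left; exact: mem_hull.
  apply: conv_hull_min; last exact: conv_hull_convex.
  move=> x [Tx|->]; last by apply: mem_hull; exact: mem_head.
  by apply: sub_hull Tx => u; rewrite inE => ->; rewrite orbT.
split.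
  (* On the pyramid [e] is minimal along the base, so the face is cut out by the maximum of
     [- e]. *)
  exists (- e.1), e.2; have E x : dot (- e.1) x = e.2 - ev e x.
    by rewrite /ev -scaleN1r dotZl; ring.
  have De x : hull (v :: T) x -> 0 <= ev e x.
    move=> Dx; rewrite -oppr_le0 -evN; apply: ev_hull_le0 Dx => y.
    rewrite inE evN oppr_le0.
    by move=> /predU1P[->|/mem_hull/Te->//]; exact: ltW.
  split=> [x Dx|]; first by rewrite E lerBlDr lerDl De.
  rewrite -FE; apply/seteqP; split=> x [Dx] /=.
    move=> sx; split=> //; rewrite E.
    suff -> : ev e x = 0 by rewrite subr0.
    by apply/eqP; rewrite eq_le De // (ev_hull_le0 es sx).
  rewrite E => h; split=> //; apply: cutE; last by lra.
  by apply: sub_hull Dx => u; rewrite !inE mem_filter => /predU1P[->|/andP[_ ->]];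
    rewrite ?eqxx ?orbT.
exists n%:Z; split.
  exists n, p; split=> // [i|x Tx].
    by apply: eT.
  have ex := Te x Tx.
  have [c [c1 ->]] := ext_aff_ev ep (lt0r_neq0 evp) (sW x (Ts x Tx)).
  move: c1; rewrite ex mul0r scale0r !(add0r, addr0) => c1.
  by exists n, p, c; split=> // i; exists i.
exists n.+1, (ext v p); split=> //.
- apply: (extP (P := hull (v :: T))) => [|i]; first by apply: mem_hull; exact: mem_head.
  by apply: sub_hull (eT _ (sp i) (ep i)) => u; rewrite inE => ->; rewrite orbT.
- exact: ext_indep.
- apply: hull_min => [x|x y a c Wx Wy _ _]; last exact: aff_hull_comb.
  rewrite inE => /predU1P[->|/mem_hull/Ts/sW//].
  by apply: aff_hull_sub; exists ord0; rewrite ?ext0.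
- by rewrite -addn1 PoszD addrK.
Qed.

End Hulls.

(** * Irredundant generators and vertices *)

Section Irredundant.
Variable R : realType.
Notation V := (dsum R).
Implicit Types (x y z v b : V) (e g l : V * R) (s t : seq V).

(** All copies of [x] are removed, so repeated entries do not affect the condition. *)
Definition irredundant s := forall x, x \in s -> ~ hull [seq y <- s | y != x] x.

Lemma irredundant_sub s :
  exists t, [/\ {subset t <= s}, hull t = hull s & irredundant t].
Proof.
have [n] := ubnP (size s); elim: n s => // n IH s; rewrite ltnS => sn.
have [h|] := pselect (irredundant s); first by exists s; split.
move=> /existsNP[x /not_implyP[xs /contrapT sx]].
have lt_s : (size [seq y <- s | y != x] < n)%N.
  apply: leq_trans sn; rewrite size_filter -[X in (_ < X)%N](count_predT s).
  by apply: (@count_lt _ _ _ _ x); rewrite ?eqxx.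
have [t [ts tE it]] := IH _ lt_s.
exists t; split=> //.
  by move=> y /ts; rewrite mem_filter => /andP[].
rewrite tE; apply/seteqP; split.
  by apply: sub_hull => y; rewrite mem_filter => /andP[].
apply: hull_sub_hull => y ys; have [->//|yx] := eqVneq y x.
by apply: mem_hull; rewrite mem_filter yx.
Qed.

Lemma irredundant_exposed s x : irredundant s -> x \in s ->
  exists2 e, ev e x = 0 & forall y, y \in s -> y != x -> ev e y < 0.
Proof.
move=> is_ xs; have [f fs fx] := separation (is_ x xs).
exists (f.1, f.2 - ev f x); first by rewrite /ev /= addrA subrr.
move=> y ys yx; suff : ev f y <= 0 by rewrite /ev /= addrA subr_lt0 => h; apply: le_lt_trans h fx.
by apply: fs; rewrite mem_filter yx.
Qed.

Lemma hull1 x y : hull [:: x] y -> y = x.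
Proof.
move=> h; suff : [set x] y by [].
move: h; apply: hull_min => [z|_ _ a b -> -> _ _ ab]; first by rewrite inE => /eqP.
by rewrite /= -scalerDl ab scale1r.
Qed.

Lemma irredundant_face s x e y : irredundant s -> x \in s -> ev e x = 0 ->
  (forall y, y \in s -> y != x -> ev e y < 0) -> hull s y -> ev e y = 0 -> y = x.
Proof.
move=> is_ xs ex es sy ey; apply: hull1.
have es0 z : z \in s -> ev e z <= 0.
  by move=> zs; have [->|/(es z zs)/ltW//] := eqVneq z x; rewrite ex.
apply: conv_hullS (conv_face es0 sy ey) => z [/= zs ez]; rewrite inE.
by apply/negPn/negP => /(es z zs); rewrite ez ltxx.
Qed.

Lemma irredundant_vertex s x : irredundant s -> x \in s -> vertex x (hull s).
Proof.
move=> is_ xs; have [e ex es] := irredundant_exposed is_ xs.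
have es0 z : z \in s -> ev e z <= 0.
  by move=> zs; have [->|/(es z zs)/ltW//] := eqVneq z x; rewrite ex.
exists e.1, (- e.2); split=> [y /(ev_hull_le0 es0)|]; first by rewrite /ev; lra.
apply/seteqP; split=> [_ ->|y [sy /= ey]].
  by split; [exact: mem_hull|move: ex; rewrite /ev /=; lra].
by apply: irredundant_face ex es sy _ => //; rewrite /ev ey addNr.
Qed.

Lemma irredundant_midpoint s x a b : irredundant s -> x \in s -> hull s a ->
  hull s b -> x = 2^-1 *: a + 2^-1 *: b -> a = x.
Proof.
move=> is_ xs sa sb xE; have [e ex es] := irredundant_exposed is_ xs.
have es0 z : z \in s -> ev e z <= 0.
  by move=> zs; have [->|/(es z zs)/ltW//] := eqVneq z x; rewrite ex.
apply: (irredundant_face is_ xs ex es sa).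
have := ev_hull_le0 es0 sa; have := ev_hull_le0 es0 sb.
by move: ex; rewrite {1}xE ev_comb; lra.
Qed.

(** The face consisting of [x] alone is spanned by the generators lying in it, so [x] is one of
    them. *)
Lemma vertex_mem s x : vertex x (hull s) -> x \in s.
Proof.
move=> [u [c [uc xE]]]; pose e : V * R := (u, - c).
have [sx ex] : hull s x /\ dot u x = c.
  by have : [set x] x by []; rewrite xE => -[].
have es y : y \in s -> ev e y <= 0.
  by move=> /mem_hull/uc; rewrite /ev /=; lra.
have ex0 : ev e x = 0 by rewrite /ev ex subrr.
have [[|n] [p [w [pA _ w1 _]]]] := conv_face es sx ex0.
  by move: w1; rewrite big_ord0 => /eqP; rewrite eq_sym oner_eq0.
have [/= ps pe] := pA ord0; suff <- : p ord0 = x by [].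
suff : [set x] (p ord0) by [].
by rewrite xE; split; [exact: mem_hull|move: pe; rewrite /ev /=; lra].
Qed.

Lemma Pol_hull (k : {pred R}) n (p : 'I_n -> V) s : (n <= 4)%N ->
  (forall y, y \in s -> kpoint k y) -> aff_independent p ->
  (forall i, hull s (p i)) -> hull s `<=` aff_hull (range p) -> Pol k 3 (hull s).
Proof.
move=> n4 sk ip sp sW; split.
- by exists [set` s]; first exact: finite_seq.
- exists (n%:Z - 1); last by exists n, p.
  by rewrite lerBlDr.
- by move=> v /vertex_mem/sk.
Qed.

(** Irredundant generators are vertices, and the vertices are known to be over [k]. *)
Lemma Pol_seq (k : {pred R}) P : Pol k 3 P ->
  exists s, [/\ P = hull s, irredundant s & forall y, y \in s -> kpoint k y].
Proof.
move=> [[A /finite_seqP[s ->] ->] _ vk].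
have [t [ts tE it]] := irredundant_sub s; exists t; split=> // y yt.
by apply: vk; rewrite -tE; apply: irredundant_vertex.
Qed.

End Irredundant.

(** * Adding a point, by induction on the points seen from it *)

Section AddPoint.
Variables (R : realType) (k : {pred R}).
Hypothesis hk : GRing.divring_closed k.
Notation V := (dsum R).
Implicit Types (x y z v b : V) (e g l : V * R) (s S : seq V).

Variables (d : nat) (q : 'I_d.+1 -> V).
Hypotheses (iq : aff_independent q) (d3 : (d <= 3)%N).
Notation W := (aff_hull (range q)).
Notation growth := (pyramidal_growth k 3).

Definition seen s v x :=
  exists e, [/\ forall y, y \in s -> ev e y <= 0, ev e x = 0 & 0 < ev e v].

(** The last clause excludes functionals vanishing on [W]; for [x] in [s] this places [x] on the
    relative boundary of the hull of [s] and [v]. *)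
Definition supported s v x := exists l, [/\ forall y, y \in s -> ev l y <= 0,
  ev l v <= 0, ev l x = 0 & exists2 y, W y & ev l y != 0].

(** The two functionals have opposite signs at [v], so a nonnegative combination vanishes there and
    still supports [s] at [x]. *)
Lemma seen_supported s v x : ksubset k q s -> (forall i, hull s (q i)) -> W v ->
  seen s v x -> supported s v x ->
  exists l, [/\ forall y, y \in s -> ev l y <= 0,
    ev l v = 0, ev l x = 0 & exists2 y, W y & ev l y != 0].
Proof.
move=> sk qs Wv [e [es ex ev0]] [l [ls lv lx lq]].
have E y : ev (- ev l v *: e + ev e v *: l) y = - ev l v * ev e y + ev e v * ev l y.
  by rewrite evD !evZ.
exists (- ev l v *: e + ev e v *: l); split.
- move=> y ys; rewrite E; have := es y ys; have := ls y ys; nra.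
- by rewrite E; ring.
- by rewrite E ex lx !mulr0 addr0.
have [lv0|lvn] := eqVneq (ev l v) 0.
  case: lq => y Wy ly; exists y => //.
  by rewrite E lv0 oppr0 mul0r add0r mulf_neq0 // gt_eqF.
have [|y ys ey] := exists_neg qs Wv es; first by rewrite gt_eqF.
exists y; first by case: (sk y ys).
have lvn0 : ev l v < 0 by rewrite lt_neqAle lvn.
have := ls y ys => ly; rewrite E lt_eqF //; nra.
Qed.

(* At least two barycentric coordinates of [w] would be negative; as [d <= 3],
   this leaves exactly three points, and the third one lies in the relative
   interior of the triangle of [w] and the first two, contradicting [l]. *)
Lemma some_unseen s v w g (t : 'I_d -> V) : aff_independent t ->
  (forall i, t i \in s) -> (forall i, W (t i)) -> (forall i, ev g (t i) = 0) ->
  W v -> 0 < ev g v -> W w -> ev g w = 0 ->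
  (d = 3%N -> forall i, exists l, [/\ forall j, ev l (t j) <= 0, ev l w <= 0,
     ev l v = 0, ev l (t i) = 0 & exists2 y, W y & ev l y != 0]) ->
  exists i, ~ seen s w (t i).
Proof.
move=> it ts Wt gt Wv gv Ww gw hl; apply: contrapT => /forallNP h.
have {}h i : seen s w (t i) by apply: contrapT.
have tv : ~ aff_hull (range t) v.
  by move=> /(ev_aff_range0 gt) g0; rewrite g0 ltxx in gv.
have [c []] := ext_aff_ev gt (lt0r_neq0 gv) (flat_full it Wt Wv tv Ww).
rewrite gw mul0r scale0r addr0 add0r => c1 wE.
(* The functional by which [t j] is seen vanishes at [t j], so its positive value at [w] needs a
   negative weight elsewhere. *)
have neg j : exists2 i, i != j & c i < 0.
  have [e [es ej ew]] := h j; apply: contrapT => hn.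
  move: ew; rewrite wE ev_sum // ltNge => /negP; apply.
  apply: sumr_le0 => i _; have := es _ (ts i).
  have [->|ij] := eqVneq i j; first by rewrite ej mulr0.
  have [ci|ci _] := ltP (c i) 0; first by case: hn; exists i.
  by have := es _ (ts i); nra.
have [i3 c3] : exists i, 0 < c i.
  apply: contrapT => /forallNP hn.
  have : \sum_i c i <= 0.
    by apply: sumr_le0 => i _; rewrite leNgt; apply/negP.
  by rewrite c1 ler10.
have [i1 i13 c1n] := neg i3.
have [i2 i21 c2n] := neg i1.
have i23 : i2 != i3 by apply/eqP => i23; move: c2n; rewrite i23 ltNge ltW.
have us : uniq [:: i1; i2; i3] by rewrite /= !inE negb_or eq_sym i21 i13 i23.
have d3E : d = 3%N.
  apply/eqP; rewrite eqn_leq d3 -[X in (_ <= X)%N]card_ord.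
  have <- : #|[:: i1; i2; i3]| = 3%N by exact/card_uniqP.
  exact: max_card.
have all3 i : i \in [:: i1; i2; i3].
  have [] := @uniq_min_size _ [:: i1; i2; i3] (enum 'I_d) us.
  - by move=> j _; rewrite mem_enum.
  - by rewrite size_enum_ord.
  - by move=> _ ->; rewrite mem_enum.
have [l [lt lw lv l3 [y Wy ly]]] := hl d3E i3.
(* Only [i3] has a positive weight, and [l] vanishes at [t i3]; so all terms are nonnegative with
   sum [ev l w <= 0], and [l] vanishes on all of [t]. *)
have cl i : 0 <= c i * ev l (t i).
  have := all3 i; rewrite !inE => /or3P[]/eqP ->.
  - by rewrite mulr_le0 // ltW.
  - by rewrite mulr_le0 // ltW.
  - by rewrite l3 mulr0.
have /eqP : \sum_i c i * ev l (t i) = 0.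
  apply/eqP; rewrite eq_le sumr_ge0 // andbT.
  by move: lw; rewrite wE ev_sum.
rewrite psumr_eq0 // => /allP cl0.
have lt0 i : ev l (t i) = 0.
  have := cl0 i; rewrite mem_index_enum => /(_ isT); rewrite /= mulf_eq0.
  case/orP=> /eqP // ci0; have := all3 i.
  by rewrite !inE => /or3P[]/eqP E; move: ci0 c1n c2n c3; rewrite E ?l3 // => ->;
    rewrite ltxx.
move/eqP: ly; apply; apply: ev_aff_range0 (flat_full it Wt Wv tv Wy).
by apply: (extP (P := fun y => ev l y = 0)).
Qed.

Lemma kpoint_crossing v g b : rational k q g -> kpoint k v -> W v ->
  kpoint k b -> W b -> 0 < ev g v -> ev g b <= 0 ->
  kpoint k (crossing g v b) /\ W (crossing g v b).
Proof.
move=> rg kv Wv kb Wb gv gb; split; last first.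
  have [a [c [_ _ ac -> _]]] := crossingP gv gb; exact: aff_hull_comb.
have gvk := rg v Wv kv; have gbk := rg b Wb kb.
have kN u : u \in k -> - u \in k.
  by move=> uk; have [_ kB _] := hk; rewrite -sub0r kB // -(subrr u) kB.
have kdiv u w : u \in k -> w \in k -> u / w \in k by have [_ _] := hk; apply.
have kB u w : u \in k -> w \in k -> u - w \in k by have [_ h _] := hk; apply: h.
by apply: (kpoint_comb hk) => //; apply: kdiv; rewrite ?kB ?kN.
Qed.

Lemma Pol_ksubset s : ksubset k q s -> (forall i, hull s (q i)) -> Pol k 3 (hull s).
Proof.
move=> sk qs; apply: (Pol_hull (p := q)) => //; last exact: ksubsetW sk.
by move=> y /sk[].
Qed.

(* [L] bounds the set of points seen from [v]; the induction is on its size. *)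
Lemma growth_add s v : ksubset k q s -> (forall i, hull s (q i)) ->
  kpoint k v -> W v ->
  (d = 3%N -> forall x, x \in s -> seen s v x -> supported s v x) ->
  growth (hull s) (hull (v :: s)).
Proof.
have [L] : exists L : seq V, forall x, x \in s -> seen s v x -> x \in L by exists s.
have [n] := ubnP (size L); elim: n L s v => // n IH L s v.
rewrite ltnS => Ln sL sk qs kv Wv sup.
have [sv|sv] := pselect (hull s v).
  have -> : hull (v :: s) = hull s.
    apply/seteqP; split; last by apply: sub_hull => y ys; rewrite inE ys orbT.
    by apply: hull_sub_hull => y; rewrite inE => /predU1P[->//|]; exact: mem_hull.
  exact: rt_refl.
have [g [t [gs gv [ts gt] it rg]]] := rational_facet hk iq sk qs Wv sv.
pose Sg := [seq x <- s | `[< seen s v x >]].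
have Sgs x : x \in Sg -> x \in s /\ seen s v x.
  by rewrite mem_filter => /andP[/asboolP].
pose cr := crossing g v.
have crP b : b \in s -> exists a c : R,
    [/\ 0 < a, 0 <= c, a + c = 1, cr b = a *: b + c *: v & ev g (cr b) = 0].
  by move=> bs; apply: crossingP => //; apply: gs.
have Wt i : W (t i) by have [] := sk _ (ts i).
have crk b : b \in s -> kpoint k (cr b) /\ W (cr b).
  by move=> bs; have [kb Wb] := sk b bs; apply: kpoint_crossing => //; exact: gs.
have tL i : t i \in L.
  by apply: sL => //; exists g; split.
have mono B : {subset B <= Sg} -> ksubset k q ([seq cr b | b <- B] ++ s).
  by move=> BS y; rewrite mem_cat => /orP[/mapP[b /BS/Sgs[bs _] ->]|/sk//]; exact: crk.
have qmono B i : hull ([seq cr b | b <- B] ++ s) (q i).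
  by apply: sub_hull (qs i) => y ys; rewrite mem_cat ys orbT.
have chain B : {subset B <= Sg} ->
    growth (hull s) (hull ([seq cr b | b <- B] ++ s)).
  elim: B => [|b B IHB] bB; first exact: rt_refl.
  have BS : {subset B <= Sg} by move=> y yB; apply: bB; rewrite inE yB orbT.
  apply: rt_trans (IHB BS) _ => /=.
  have [bs bseen] := Sgs b (bB b (mem_head _ _)).
  set s' := _ ++ s; have [kw Ww] := crk b bs.
  have [a [c [a0 c0 ac wE gw]]] := crP b bs; set w := cr b in wE gw kw Ww *.
  have evw e : ev e w = a * ev e b + c * ev e v by rewrite wE ev_comb.
  have ss' y : y \in s -> y \in s' by rewrite mem_cat orbC => ->.
  have seen_v e : (forall y, y \in s -> ev e y <= 0) -> 0 < ev e w -> 0 < ev e v.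
    by move=> es; rewrite evw; have := es b bs; have [//|] := ltP 0 (ev e v); nra.
  have supw x : d = 3%N -> x \in s -> seen s v x -> exists l,
      [/\ forall y, y \in s -> ev l y <= 0, ev l v = 0, ev l x = 0
        & exists2 y, W y & ev l y != 0].
    by move=> dE xs xseen; apply: seen_supported (sup dE x xs xseen).
  have ls' l : (forall y, y \in s -> ev l y <= 0) -> ev l v <= 0 ->
      (forall y, y \in s' -> ev l y <= 0) /\ ev l w <= 0.
    move=> ls lv; have lcr y : y \in s -> ev l (cr y) <= 0.
      move=> ys; have [a' [c' [a'0 c'0 ac' -> _]]] := crP y ys.
      by rewrite ev_comb //; have := ls y ys; nra.
    split; last exact: lcr.
    by move=> y; rewrite mem_cat => /orP[/mapP[z /BS/Sgs[zs _] ->]|/ls//]; exact: lcr.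
  (* This vertex of the facet is seen from [v] but not from [w], which lowers the bound by one. *)
  have [i0 ti0] : exists i, ~ seen s' w (t i).
    apply: (@some_unseen s' v w g t) => //; first by move=> i; apply: ss'.
    move=> dE i; have [|l [ls lv li ly]] := supw (t i) dE (ts i).
      by exists g; split.
    exists l; split=> //; first by move=> j; apply: ls.
    by have [|//] := ls' l ls; rewrite lv.
  (* Replaces each point of [B] by its crossing. The images of the points seen from [v] cover all
     points seen from [w], and [t i0] is fixed because [g] vanishes there. *)
  pose phi y := if y \in B then cr y else y.
  (* A point of [B] seen from [w] is its own crossing: otherwise the crossing, strictly nearer to
     [v], would violate [e]. *)
  have below x e : (forall y, y \in s' -> ev e y <= 0) -> 0 < ev e w ->
      x \in B -> ev e x = 0 -> cr x = x.
    move=> es' ew xB ex; have [xs _] := Sgs x (BS x xB).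
    have evp : 0 < ev e v by apply: seen_v ew => y ys; apply: es'; exact: ss'.
    have [a' [c' [a'0 c'0 ac' crE _]]] := crP x xs.
    have : ev e (cr x) <= 0.
      by apply: es'; rewrite mem_cat map_f.
    rewrite crE ev_comb // ex mulr0 add0r => h.
    have c'E : c' = 0 by apply/eqP; rewrite eq_le c'0 andbT; nra.
    by move: ac'; rewrite c'E addr0 => ->; rewrite scale1r scale0r addr0.
  have phi_s' x : x \in s' -> seen s' w x ->
      exists y, [/\ y \in s, seen s v y & x = phi y].
    move=> xs' [e [es' ex ew]].
    have es y : y \in s -> ev e y <= 0 by move=> ys; apply: es'; exact: ss'.
    have evp := seen_v e es ew.
    move: xs'; rewrite mem_cat => /orP[/mapP[y yB ->]|xs].
      by have [ys yseen] := Sgs y (BS y yB); exists y; rewrite /phi yB; split.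
    exists x; split=> //; first by exists e; split.
    by rewrite /phi; case: ifP => // xB; rewrite (below x e).
  apply: (IH [seq phi y | y <- rem (t i0) L]) => //.
  - rewrite size_map size_rem // prednK //.
    by case: (L) (tL i0).
  - move=> x xs' xseen; have [y [ys yseen xE]] := phi_s' x xs' xseen.
    rewrite xE map_f // rem_mem //; last exact: sL.
    apply/eqP => yt; apply: ti0; suff <- : x = t i0 by [].
    by rewrite xE yt /phi /cr crossing_id //; case: ifP.
  - exact: mono.
  - by move=> i; exact: qmono.
  - move=> dE x xs' xseen; have [y [ys yseen ->]] := phi_s' x xs' xseen.
    (* A functional vanishing at [y] and [v] vanishes at the crossing between them, so boundary
       points produce boundary points. *)
    have [l [ls lv ly [u Wu lu]]] := supw y dE ys yseen.
    have [|ls'1 ls'2] := ls' l ls; first by rewrite lv.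
    exists l; split=> //; last by exists u.
    rewrite /phi; case: ifP => // _; have [a' [c' [_ _ ac' -> _]]] := crP y ys.
    by rewrite ev_comb // lv ly !mulr0 addr0.
apply: rt_trans (chain Sg _) _ => //; set s' := _ ++ s.
have sk' : ksubset k q s' by exact: mono.
have qs' i : hull s' (q i) by exact: qmono.
have s's y : y \in s' -> hull (v :: s) y /\ ev g y <= 0.
  rewrite mem_cat => /orP[/mapP[b /Sgs[bs _] ->]|ys]; last first.
    by split; [apply: mem_hull; rewrite inE ys orbT|exact: gs].
  have [a [c [a0 c0 ac crE ->]]] := crP b bs; split=> //; rewrite crE.
  apply: conv_hull_convex => //; try exact: ltW; apply: mem_hull.
    by rewrite inE bs orbT.
  exact: mem_head.
have ss' : hull s `<=` hull s' by apply: sub_hull => y ys; rewrite mem_cat ys orbT.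
have QE : hull (v :: s') = hull (v :: s).
  apply/seteqP; split; apply: hull_sub_hull => y; rewrite inE => /predU1P[->|].
  - by apply: mem_hull; exact: mem_head.
  - by case/s's.
  - by apply: mem_hull; exact: mem_head.
  - by move=> ys; apply: mem_hull; rewrite inE mem_cat ys !orbT.
rewrite -QE; apply: rt_step; split.
- exact: Pol_ksubset.
- apply: Pol_ksubset; first exact: ksubset_cons.
  by move=> i; apply: sub_hull (qs' i) => y ys; rewrite inE ys orbT.
have tv : ~ aff_hull (range t) v.
  by move=> /(ev_aff_range0 gt) g0; rewrite g0 ltxx in gv.
apply: (@pyramidal_step _ _ t s' v g) => //.
- by move=> y /s's[].
- rewrite QE => x /hull_cons[a [c [p [a0 c0 ac xE hp]]]] gx.
  have [cz|cn] := eqVneq c 0.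
    move: ac gx; rewrite xE cz scale0r !addr0 => ->.
    by rewrite scale1r leNgt gv.
  (* [y] is where the segment from [p] to [v] leaves [hull s]. It is a combination of seen points,
     so its crossing lies in [hull s'], and [x] lies between [p] and [y] or between [y] and that
     crossing. *)
  have sp := hp cn; have [a' [c' [y [[a'0 c'0 ac' yE sy] [e [es ey evp]]]]]] := first_point sv sp.
  have y_seen : hull Sg y.
    apply: conv_hullS (conv_face es sy ey) => z [/= zs ez].
    by rewrite mem_filter zs andbT; apply/asboolP; exists e; split.
  have gy : ev g y <= 0 by exact: ev_hull_le0 sy.
  have Dcr : hull s' (crossing g v y).
    have /(hull_min (s := Sg)) : convex_set [set b | ev g b <= 0 /\ hull s' (crossing g v b)].
      by apply: crossing_convexr => //; exact: conv_hull_convex.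
    move=> /(_ _ y y_seen)[] // b bS; have [bs _] := Sgs b bS.
    by split; [exact: gs|apply: mem_hull; rewrite mem_cat map_f].
  have cs' : convex_set (hull s') by exact: conv_hull_convex.
  have [aa'|aa'] := leP a a'.
    have [a'z|a'n] := eqVneq a' 0.
      have az : a = 0 by lra.
      by move: ac; rewrite xE az add0r scale0r add0r => ->; rewrite scale1r; exact: ss'.
    have a'p : 0 < a' by rewrite lt_neqAle eq_sym a'n.
    have -> : x = (a / a') *: y + (1 - a / a') *: p.
      rewrite xE yE; have -> : c = 1 - a by lra.
      have -> : c' = 1 - a' by lra.
      by coefwise; field.
    have h : a / a' <= 1 by rewrite ler_pdivrMr ?mul1r.
    by apply: cs'; rewrite ?subr_ge0 ?subrKC ?divr_ge0 //; exact: ss'.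
  have c'p : 0 < c' by lra.
  have xvE : x = (1 - c / c') *: v + (c / c') *: y.
    rewrite xE yE; have -> : a = 1 - c by lra.
    have -> : a' = 1 - c' by lra.
    by coefwise; field; rewrite gt_eqF.
  have h : c / c' <= 1 by rewrite ler_pdivrMr ?mul1r //; lra.
  have h0 : 0 <= c / c' by rewrite divr_ge0.
  have h1 : 0 <= 1 - c / c' by rewrite subr_ge0.
  rewrite xvE in gx *.
  have [r [r0 r1 ->]] := before_crossing gv gy h1 h0 (subrK _ _) gx.
  by apply: cs'; rewrite ?subr_ge0 ?subrKC //; exact: ss'.
- by move=> i; apply: ss'; exact: mem_hull.
- by move=> x /(ksubsetW sk')/(flat_full it Wt Wv tv).
Qed.

End AddPoint.

(** * Cutting by facet hyperplanes and raising the dimension *)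

Section Cuts.
Variables (R : realType) (k : {pred R}).
Hypothesis hk : GRing.divring_closed k.
Notation V := (dsum R).
Implicit Types (x y z v b : V) (e g l : V * R) (s t : seq V).
Notation growth := (pyramidal_growth k 3).

Section Span.
Variables (d : nat) (q : 'I_d.+1 -> V).
Hypotheses (iq : aff_independent q) (d3 : (d <= 3)%N).
Notation W := (aff_hull (range q)).

Lemma dot_comb_ev l n (p : 'I_n -> V) (w : 'I_n -> R) : \sum_i w i = 0 ->
  dot l.1 (\sum_i w i *: p i) = \sum_i w i * ev l (p i).
Proof.
move=> w0; under [RHS]eq_bigr do rewrite mulrDr.
rewrite big_split /= -mulr_suml w0 mul0r addr0.
rewrite (big_morph (dot l.1) (dotDr l.1) (id1 := 0)).
  by apply: eq_bigr => i _; rewrite dotZr.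
by rewrite -(scale0r (0 : V)) dotZr mul0r.
Qed.

(** Weights of sum zero along which [g] is constant satisfy two linear equations in [d.+1] unknowns.
    The resulting direction is parallel to [W], so a functional varying along it cannot vanish on
    [W]. *)
Lemma level_direction g : (2 <= d)%N -> exists z,
  [/\ z != 0, dot g.1 z = 0
    & forall l, dot l.1 z != 0 -> exists2 y, W y & ev l y != 0].
Proof.
move=> d2; pose M := \matrix_(i < d.+1, j < 2) if j == 0 then 1 else ev g (q i).
have : kermx M != 0.
  rewrite kermx_eq0 -row_leq_rank -ltnNge.
  exact: leq_ltn_trans (rank_leq_col M) _.
case/rowV0Pn => w /sub_kermxP wM wn.
have w0 : \sum_i w 0 i = 0.
  have /matrixP/(_ 0 0) := wM; rewrite !mxE => h; rewrite -[RHS]h.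
  by apply: eq_bigr => i _; rewrite mxE eqxx mulr1.
have wg : \sum_i w 0 i * ev g (q i) = 0.
  have /matrixP/(_ 0 1) := wM; rewrite !mxE => h; rewrite -[RHS]h.
  by apply: eq_bigr => i _; rewrite mxE.
exists (\sum_i w 0 i *: q i); split.
- by apply: contraNneq wn => wq; apply/eqP/rowP => i; rewrite mxE; exact: iq wq i.
- by rewrite dot_comb_ev.
move=> l; rewrite dot_comb_ev // => ln; apply: contrapT => h; move/eqP: ln; apply.
rewrite big1 // => i _; have [->|n0] := eqVneq (ev l (q i)) 0; first by rewrite mulr0.
by case: h; exists (q i) => //; exact: aff_range_mem.
Qed.

(* Were [x] interior to [hull s], it would be the midpoint of a segment in
   [hull s] along which [g] is constant. *)
Lemma boundary_vertex s t g x : (2 <= d)%N -> irredundant t -> x \in t ->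
  hull s x -> (forall y, hull s y -> ev g y = ev g x -> hull t y) ->
  exists l, [/\ forall y, y \in s -> ev l y <= 0, ev l x = 0
    & exists2 y, W y & ev l y != 0].
Proof.
move=> d2 it xt sx st; have [z [zn gz zW]] := level_direction g d2.
have [[a a0 ha]|[l [ls lx lz]]] := feasible_direction z sx; last first.
  by exists l; split=> //; apply: zW; rewrite gt_eqF.
have [[b b0 hb]|[l [ls lx lz]]] := feasible_direction (- z) sx; last first.
  exists l; split=> //; apply: zW; apply: contraTneq lz => lz.
  by rewrite -sub0r dotBr lz subr0 -(scale0r (0 : V)) dotZr mul0r ltxx.
pose m := Num.min a b.
have m0 : 0 < m by rewrite lt_min a0.
have move_in u c : 0 < c -> m <= c -> hull s (x + c *: u) -> hull s (x + m *: u).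
  move=> c0 mc hc.
  have -> : x + m *: u = (m / c) *: (x + c *: u) + (1 - m / c) *: x.
    by coefwise; field; rewrite gt_eqF.
  have h : m / c <= 1 by rewrite ler_pdivrMr ?mul1r.
  apply: conv_hull_convex; rewrite ?subr_ge0 ?subrKC //.
  by rewrite divr_ge0 // ltW.
have {}ha : hull t (x + m *: z).
  apply: st; first by apply: move_in ha; rewrite ?ge_min ?lexx.
  by apply/eqP; rewrite -subr_eq0 evB addrAC subrr add0r dotZr gz mulr0.
have {}hb : hull t (x + m *: - z).
  apply: st; first by apply: move_in hb; rewrite ?ge_min ?lexx ?orbT.
  apply/eqP; rewrite -subr_eq0 evB addrAC subrr add0r scalerN -scaleNr.
  by rewrite dotZr gz mulr0.
have : x + m *: z = x.
  by apply: (irredundant_midpoint it xt ha hb); coefwise; field.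
move/eqP; rewrite -subr_eq0 addrAC subrr add0r scaler_eq0 (negPf zn) orbF.
by rewrite gt_eqF.
Qed.

Lemma growth_cut s g : irredundant s -> ksubset k q s -> (forall i, hull s (q i)) ->
  rational k q g -> (forall i, ev g (q i) <= 0) ->
  exists t, [/\ irredundant t, ksubset k q t, growth (hull t) (hull s)
    & hull t = hull s `&` [set x | ev g x <= 0]].
Proof.
move=> is_ sk qs rg gq.
have [t [ts tE it]] := irredundant_sub (cut g s).
have cutE : hull t = hull s `&` [set x | ev g x <= 0].
  rewrite tE; apply/seteqP; split=> [x cx|x [sx gx]]; last exact: hull_cut.
  split; first by apply: hull_sub_hull cx => y /mem_cut[].
  by apply: ev_hull_le0 cx => y /mem_cut[].
have tk : ksubset k q t.
  move=> y /ts; rewrite mem_cat => /orP[|/allpairsP[[v b] /=]].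
    by rewrite mem_filter => /andP[_ /sk].
  rewrite !mem_filter => -[/andP[gv /sk[kv Wv]] /andP[gb /sk[kb Wb]] ->].
  exact: kpoint_crossing.
have qt i : hull t (q i) by rewrite cutE; split; [exact: qs|exact: gq].
exists t; split=> //.
have chain s1 : {subset s1 <= s} -> growth (hull t) (hull (s1 ++ t)).
  elim: s1 => [|v s1 IH] vs1; first exact: rt_refl.
  have s1s : {subset s1 <= s} by move=> y ys; apply: vs1; rewrite inE ys orbT.
  have [kv Wv] := sk v (vs1 v (mem_head _ _)).
  have sub_s y : y \in v :: s1 ++ t -> hull s y.
    rewrite inE mem_cat => /or3P[/eqP ->|/s1s ys|yt].
    - by apply: mem_hull; apply: vs1; exact: mem_head.
    - exact: mem_hull.
    - by have := mem_hull yt; rewrite cutE => -[].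
  apply: rt_trans (IH s1s) _; apply: (growth_add hk iq d3) => //.
  - by apply: ksubset_cat => // y /s1s/sk.
  - by move=> i; apply: sub_hull (qt i) => y yt; rewrite mem_cat yt orbT.
  move=> dE x xs1 _.
  (* [x] is a generator of [s] or of the section [t]. In the second case points of [hull s] at the
     same level of [g] lie in the section, so [boundary_vertex] applies in both. *)
  have [l [ls lx lW]] : exists l, [/\ forall y, y \in s -> ev l y <= 0, ev l x = 0
      & exists2 y, W y & ev l y != 0].
    have d2 : (2 <= d)%N by rewrite dE.
    have sx : hull s x by apply: sub_s; rewrite inE xs1 orbT.
    move: xs1; rewrite mem_cat => /orP[/s1s xs|xt].
      by apply: (@boundary_vertex s s g).
    apply: (@boundary_vertex s t g) => // y sy gy; rewrite cutE; split=> //=.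
    by rewrite gy; have := mem_hull xt; rewrite cutE => -[].
  exists l; split=> //.
    by move=> y ys1; apply: (ev_hull_le0 ls); apply: sub_s; rewrite inE ys1 orbT.
  by apply: (ev_hull_le0 ls); apply: sub_s; exact: mem_head.
suff -> : hull s = hull (s ++ t) by exact: chain.
apply/seteqP; split; first by apply: sub_hull => y ys; rewrite mem_cat ys.
apply: hull_sub_hull => y; rewrite mem_cat => /orP[/mem_hull//|/mem_hull].
by rewrite cutE => -[].
Qed.

Lemma growth_full s t : (forall y, y \in s -> kpoint k y) ->
  (forall i, hull s (q i)) -> hull s `<=` hull t -> ksubset k q t ->
  irredundant t -> growth (hull s) (hull t).
Proof.
move=> sk qs st tk it.
have sW : hull s `<=` W by move=> x /st; exact: ksubsetW tk x.
have sks : ksubset k q s by move=> y ys; split; [exact: sk|exact/sW/mem_hull].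
have [G [rG Gs sG]] := facet_list hk iq sks qs.
have {}sG : forall x, hull t x -> (forall e, e \in G -> ev e x <= 0) -> hull s x.
  by move=> x tx; apply: sG; exact: ksubsetW tk x tx.
have {Gs} : forall e, e \in G -> forall x, hull s x -> ev e x <= 0.
  by move=> e /Gs h x; exact: ev_hull_le0.
(* [t] is cut by one facet functional at a time; once the list is exhausted, both hulls agree. *)
move: st tk it rG sG; elim: G t => [|e G IH] t st tk it rG sG Gs.
  have -> : hull s = hull t; last exact: rt_refl.
  by apply/seteqP; split=> // x tx; apply: sG.
have [|||t' [it' tk' gr tE]] := @growth_cut t e it tk _ _ _.
- by move=> i; exact: st.
- by apply: rG; exact: mem_head.
- by move=> i; apply: Gs (qs i); exact: mem_head.
apply: rt_trans gr; apply: IH => //.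
- by move=> x sx; rewrite tE; split; [exact: st|apply: Gs sx; exact: mem_head].
- by move=> f fG; apply: rG; rewrite inE fG orbT.
- move=> x; rewrite tE => -[tx ex] xG; apply: sG => // f.
  by rewrite inE => /predU1P[->|/xG].
- by move=> f fG; apply: Gs; rewrite inE fG orbT.
Qed.

End Span.

(** A generator of [t] outside the affine hull of [hull s] is the apex of a pyramid over all of
    [hull s]; this is repeated, with [m - n] decreasing, until [hull t] is contained in the affine
    hull. *)
Lemma growth_raise m (r : 'I_m -> V) t n (p : 'I_n -> V) s : (m <= 4)%N ->
  (forall y, y \in t -> kpoint k y) -> hull t `<=` aff_hull (range r) ->
  (forall y, y \in s -> kpoint k y) -> hull s `<=` hull t ->
  aff_independent p -> (forall i, hull s (p i)) -> hull s `<=` aff_hull (range p) ->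
  exists s' n' (p' : 'I_n' -> V), [/\ growth (hull s) (hull s'),
    (forall y, y \in s' -> kpoint k y) /\ hull s' `<=` hull t,
    aff_independent p' /\ (n' <= m)%N, forall i, hull s' (p' i)
    & hull t `<=` aff_hull (range p')].
Proof.
move=> m4 tk tr; have [j] := ubnP (m - n); elim: j n p s => // j IH n p s jn.
move=> sk st ip sp sW.
have nm : (n <= m)%N.
  by apply: (aff_indep_card ip (q := r)) => i; apply: tr; exact: st.
have [h|] := pselect (forall y, y \in t -> aff_hull (range p) y).
  exists s, n, p; split=> //; first exact: rt_refl.
  by apply: hull_min => // x y a b px py _ _; exact: aff_hull_comb.
move=> /existsNP[y /not_implyP[yt yp]].
have ip' := ext_indep ip yp.
have nm' : (n.+1 <= m)%N.
  apply: (aff_indep_card ip' (q := r)); apply: (extP (P := aff_hull (range r))).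
    by apply: tr; exact: mem_hull.
  by move=> i; apply: tr; exact: st.
have rE : range p = [set` [seq p i | i : 'I_n]].
  apply/seteqP; split=> x /=; first by case=> i _ <-; exact: codom_f.
  by move=> /codomP[i ->]; exists i.
have [e ep ey] : exists2 e, (forall i, ev e (p i) = 0) & 0 < ev e y.
  have [|e ep ey] := @aff_separation _ [seq p i | i : 'I_n] y; first by rewrite -rE.
  by exists e => // i; apply: ep; exact: codom_f.
have es x : hull s x -> ev e x = 0 by move=> /sW; exact: ev_aff_range0.
have ss : hull s `<=` hull (y :: s).
  by apply: sub_hull => u us; rewrite inE us orbT.
have sp' i : hull (y :: s) (ext y p i).
  apply: (extP (P := hull (y :: s))) => [|{}i]; last exact/ss.
  by apply: mem_hull; exact: mem_head.
have sW' : hull (y :: s) `<=` aff_hull (range (ext y p)).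
  apply: hull_min => [x|x1 x2 a b W1 W2 _ _]; last exact: aff_hull_comb.
  rewrite inE => /predU1P[->|/mem_hull/sW].
    by apply: aff_hull_sub; exists ord0; rewrite ?ext0.
  by apply: aff_hullS => _ [i _ <-]; apply: aff_hull_sub; exists (lift ord0 i);
    rewrite ?extS.
have sk' u : u \in y :: s -> kpoint k u.
  by rewrite inE => /predU1P[->|/sk//]; exact: tk.
have [||s' [n' [p' [gr h1 h2 h3 h4]]]] := IH n.+1 (ext y p) (y :: s) _ sk' _ ip' sp' sW'.
- by rewrite ltnS in jn; apply: leq_trans jn; rewrite ltn_sub2l.
- by apply: hull_sub_hull => u; rewrite inE => /predU1P[->|/mem_hull/st//]; exact: mem_hull.
exists s', n', p'; split=> //; apply: rt_trans gr; apply: rt_step; split.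
- by apply: (Pol_hull (p := p)) => //; exact: leq_trans m4.
- by apply: (Pol_hull (p := ext y p)) => //; exact: leq_trans m4.
apply: (@pyramidal_step _ _ p s y e) => //.
- by move=> u /mem_hull/es ->.
- move=> x /hull_cons[a [c [u [a0 c0 ac xE hu]]]]; rewrite xE ev_comb //.
  have [cz|cn] := eqVneq c 0.
    by move: ac; rewrite cz addr0 => ->; rewrite mul1r mul0r addr0 leNgt ey.
  rewrite (es u (hu cn)) mulr0 addr0 pmulr_lle0 // => a0'.
  have az : a = 0 by apply/eqP; rewrite eq_le a0'.
  by move: ac; rewrite az add0r scale0r add0r => ->; rewrite scale1r; exact: hu.
- by move=> x /ss/sW'.
Qed.

Lemma growth_sub P Q : Pol k 3 P -> Pol k 3 Q -> P `<=` Q -> growth P Q.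
Proof.
move=> hP hQ; have [s [PE is_ sk]] := Pol_seq hP; have [t [QE it tk]] := Pol_seq hQ.
subst P Q; move=> st.
have [_ [e1 e13 [n [p [sp ip sW e1E]]]] _] := hP.
have [_ [e2 e23 [m [r [tr ir tW e2E]]]] _] := hQ.
have m4 : (m <= 4)%N by move: e23; rewrite e2E lerBlDr.
have [s' [n' [p' [gr [sk' st'] [ip' n'm] sp' tp']]]] :=
  growth_raise m4 tk tW sk st ip sp sW.
apply: rt_trans gr _.
(* With no basis points [hull t] is empty, and the two hulls coincide. *)
case: n' p' ip' n'm sp' tp' => [|d] q iq n'm qs tq.
  have t0 x : ~ hull t x.
    move=> /tq[[|j] [u [w [uP w1 _]]]].
      by move: w1; rewrite big_ord0 => /eqP; rewrite eq_sym oner_eq0.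
    by have [[]] := uP ord0.
  suff -> : hull s' = hull t by exact: rt_refl.
  by apply/seteqP; split=> x; [move/st'|]; move/t0.
apply: (@growth_full d q iq _ s' t) => //.
  by rewrite -ltnS; exact: leq_trans m4.
by move=> y yt; split; [exact: tk|apply: tq; exact: mem_hull].
Qed.

End Cuts.

(** * Pyramidal growth and inclusion in dimension at most three *)

Theorem theoremB (R : realType) (k : {pred R}) (hk : GRing.divring_closed k)
    (P Q : set (dsum R)) (hP : Pol k 3 P) (hQ : Pol k 3 Q) :
  (pyramidal_growth k 3 P Q <-> P `<=` Q) /\
  (P `<=` Q ->
    exists (m : nat) (S : nat -> set (dsum R)),
      [/\ S 0%N = P, S m = Q,
          forall j, (j <= m)%N -> Pol k 3 (S j)
        & forall j, (j < m)%N -> pyramidal_extension (S j) (S j.+1)]).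
Proof.
split; [split|].
- by elim=> [A B [_ _ []]//|A|A B C _ AB _ BC x /AB/BC].
- exact: growth_sub.
(* This form of the closure exposes the first step, so the chain is built by prepending one polytope
   at a time. *)
move=> PQ; have h := clos_rt_rt1n _ _ _ _ (growth_sub hk hP hQ PQ).
move: hP hQ; elim: h => [A PA _|A B C [PA PB AB] _ IH _ PC].
  by exists 0%N, (fun=> A); split.
have [m [S [S0 Sm PS extS]]] := IH PB PC.
exists m.+1, (fun j => if j is i.+1 then S i else A); split=> //.
- by case=> [|j] //; exact: PS.
- by case=> [|j] //=; [rewrite S0|exact: extS].
Qed.
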